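(* Let $d\ge1$, $\alpha\in(0,2]$, and let the covariance $\gamma=I_{d-\beta}\mu$ satisfy Assumption (A) of the context. Then there exist a number $2q\in\big(1,\frac{2d}{2d-\alpha}\wedge\frac{d+\alpha}{d}\big)$ and a constant $C$ such that for any functions $f,g\in L^{2q}(\mathbb{R}^d)$, $$\int_{\mathbb{R}^d}f(y)\,[g*\gamma](y)\,dy\le C\,\|f\|_{L^{2q}(\mathbb{R}^d)}\,\|g\|_{L^{2q}(\mathbb{R}^d)}.$$
   Context: $\gamma$ is a nonnegative and nonnegative definite symmetric measure on $\mathbb{R}^d$ and $(g*\gamma)(y)=\int_{\mathbb{R}^d}g(y-x)\,d\gamma(x)$. When $2d-\alpha=0$, $\frac{2d}{2d-\alpha}$ is read as $+\infty$. Riesz potential: for $0<\beta<d$, $(I_{d-\beta}\mu)(x)=\int_{\mathbb{R}^d}|x-y|^{-\beta}d\mu(y)$ (identified with the measure having this density); for $\beta=d$, $I_{d-\beta}\mu=\mu$. Assumption (A): $\gamma=I_{d-\beta}\mu$ with $0<\beta\le d$ and $\mu$ a finite symmetric measure on $\mathbb{R}^d$, and one of the following holds: (i) $\beta<\alpha\wedge d$; (ii) $\beta=d=1$ and $\alpha>1$; (iii) $\beta=d\ge\alpha$ and $\mu=\gamma$ is absolutely continuous with density $\gamma\in L^r(\mathbb{R}^d)$ for some $r>d/\alpha$, and in addition, if $r>2$, the condition $\int_{\mathbb{R}^d}\frac{\widehat\gamma(d\xi)}{\lambda+|\xi|^\alpha}<\infty$ holds for some (hence all) $\lambda>0$, where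 $\widehat\gamma$ is the Fourier transform of $\gamma$. *)

(* Defs.v *)
From HB Require Import structures.
From mathcomp Require Import all_boot all_order all_algebra.
From mathcomp Require Import complex.
From mathcomp Require Import all_classical all_reals all_analysis.

Set Implicit Arguments.
Unset Strict Implicit.
Unset Printing Implicit Defensive.

Import Order.TTheory GRing.Theory Num.Theory.
Import numFieldNormedType.Exports.

Local Open Scope classical_set_scope.
Local Open Scope ring_scope.

(* R^d is 'rV[R]_d.  It gets the product of the Borel sigma-algebras of its
   coordinates, which is the Borel sigma-algebra of R^d; the library provides
   the topology of 'rV[R]_d but no measurable structure on it. *)
Definition rV_display : measure_display.
Proof. exact: default_measure_display. Qed.

Section measurable_rV.
Context {R : realType} (d : nat).

Let coord (i : 'I_d) (x : 'rV[R]_d) : measurableTypeR R := x ord0 i.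

Let rV_set0 : g_sigma_preimage coord set0.
Proof. exact: sigma_algebra0. Qed.

Let rV_setC A : g_sigma_preimage coord A -> g_sigma_preimage coord (~` A).
Proof. exact: sigma_algebraC. Qed.

Let rV_bigcup (F : (set 'rV[R]_d)^nat) :
  (forall i, g_sigma_preimage coord (F i)) ->
  g_sigma_preimage coord (\bigcup_i (F i)).
Proof. exact: sigma_algebra_bigcup. Qed.

HB.instance Definition _ := @isMeasurable.Build
  rV_display 'rV[R]_d (g_sigma_preimage coord) rV_set0 rV_setC rV_bigcup.

End measurable_rV.

Lemma sigma_finite_product d1 d2 (T1 : measurableType d1)
    (T2 : measurableType d2) (R : realType)
    (m1 : {sigma_finite_measure set T1 -> \bar R})
    (m2 : {sigma_finite_measure set T2 -> \bar R}) :
  sigma_finite setT (m1 \x m2)%E.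
Proof.
have /sigma_finiteP[F [TF ndF Foo]] := sigma_finiteT m1.
have /sigma_finiteP[G [TG ndG Goo]] := sigma_finiteT m2.
exists (fun n => F n `*` G n).
  rewrite -setXTT TF TG predeqE => -[x y]; split.
    move=> [/= [n _ Fnx] [k _ Gky]]; exists (maxn n k) => //; split.
    - by move: x Fnx; exact/subsetPset/ndF/leq_maxl.
    - by move: y Gky; exact/subsetPset/ndG/leq_maxr.
  by move=> [n _ []/= ? ?]; split; exists n.
move=> k; have [? ?] := Foo k; have [? ?] := Goo k.
split; first exact: measurableX.
by rewrite product_measure1E// lte_mul_pinfty// ge0_fin_numE.
Qed.

Section lebesgue_rV.
Context {R : realType}.
Implicit Type n : nat.

Lemma measurable_rV_coord n (i : 'I_n) :
  measurable_fun [set: 'rV[R]_n]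
    ((fun x => x ord0 i) : 'rV[R]_n -> measurableTypeR R).
Proof.
move=> _ Y mY; rewrite setTI; apply: sub_sigma_algebra => /=.
rewrite -bigcup_seq/=; exists i => /=; first by rewrite mem_index_enum.
by exists Y => //; rewrite setTI.
Qed.

Lemma measurable_fun_rV d (T : measurableType d) n (f : T -> 'rV[R]_n) :
  (forall i, measurable_fun [set: T]
     ((fun x => f x ord0 i) : T -> measurableTypeR R)) ->
  measurable_fun [set: T] f.
Proof.
move=> mf; apply: measurability => //.
move=> _ [A /= + <-].
rewrite -bigcup_seq => -[i _] [B mB <-].
by rewrite !setTI -[X in measurable X]setTI; exact: mf.
Qed.

Definition cons_rV n (p : measurableTypeR R * 'rV[R]_n) : 'rV[R]_n.+1 :=
  row_mx (p.1 : R)%:M p.2.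

Lemma cons_rV0 n p : @cons_rV n p ord0 ord0 = p.1.
Proof.
have -> : (ord0 : 'I_n.+1) = lshift n (ord0 : 'I_1) by exact: val_inj.
by apply: etrans (row_mxEl _ _ _ _) _; rewrite mxE eqxx mulr1n.
Qed.

Lemma cons_rVS n p (j : 'I_n) : cons_rV p ord0 (lift ord0 j) = p.2 ord0 j.
Proof.
have -> : lift ord0 j = rshift 1 j by exact: val_inj.
exact: row_mxEr.
Qed.

Lemma measurable_cons_rV n : measurable_fun setT (@cons_rV n).
Proof.
apply: measurable_fun_rV => i; have [j ->|->] := unliftP ord0 i.
- under eq_fun do rewrite cons_rVS.
  exact: (measurableT_comp (@measurable_rV_coord n j) measurable_snd).
- under eq_fun do rewrite cons_rV0.
  exact: measurable_fst.
Qed.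

Section step.
Context n (m : {sigma_finite_measure set 'rV[R]_n -> \bar R}).

Definition lebesgue_rV_step : set 'rV[R]_n.+1 -> \bar R :=
  pushforward (lebesgue_measure \x m)%E (@cons_rV n).

Let mcons := @measurable_cons_rV n.

Let step0 : lebesgue_rV_step set0 = 0%E.
Proof. by apply: measure0 => //; exact: mcons. Qed.

Let step_ge0 A : (0 <= lebesgue_rV_step A)%E.
Proof. by apply: measure_ge0 => //; exact: mcons. Qed.

Let step_sigma_additive : semi_sigma_additive lebesgue_rV_step.
Proof. by apply: measure_semi_sigma_additive => //; exact: mcons. Qed.

HB.instance Definition _ := isMeasure.Build _ _ _ lebesgue_rV_step
  step0 step_ge0 step_sigma_additive.

Let sigma_finite_step : sigma_finite setT lebesgue_rV_step.
Proof.
have [F TF Foo] := sigma_finite_product lebesgue_measure m.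
pose unc (x : 'rV[R]_n.+1) : measurableTypeR R * 'rV[R]_n :=
  (x ord0 ord0, \row_j x ord0 (lift ord0 j)).
have consK : cancel (@cons_rV n) unc.
  move=> p; rewrite /unc cons_rV0 [RHS]surjective_pairing; congr pair.
  by apply/rowP => j; rewrite mxE cons_rVS.
have munc : measurable_fun setT unc.
  apply/measurable_fun_pairP; split; first exact: measurable_rV_coord.
  apply: measurable_fun_rV => j /=; under eq_fun do rewrite mxE.
  exact: measurable_rV_coord.
exists (fun k => unc @^-1` F k).
  by rewrite -preimage_bigcup -TF preimage_setT.
move=> k; have [mFk Fkoo] := Foo k; split.
  by rewrite -[X in measurable X]setTI; exact: munc.
rewrite /lebesgue_rV_step /pushforward -comp_preimage.
by rewrite (_ : unc \o _ = id)//; apply/funext => p /=; rewrite consK.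
Qed.

HB.instance Definition _ := Measure_isSigmaFinite.Build _ _ _
  lebesgue_rV_step sigma_finite_step.

End step.

(* Lebesgue measure on R^d, as the d-fold product of the one on R. *)
Fixpoint lebesgue_rV n : {sigma_finite_measure set 'rV[R]_n -> \bar R} :=
  match n with
  | 0 => \d_(0 : 'rV[R]_0)
  | n'.+1 => lebesgue_rV_step (lebesgue_rV n')
  end.

Lemma lebesgue_rV_box n (A : 'I_n -> set (measurableTypeR R)) :
  (forall i, measurable (A i)) ->
  lebesgue_rV n [set x | forall i, A i (x ord0 i)] =
  (\prod_(i < n) lebesgue_measure (A i))%E.
Proof.
elim: n A => [|n IH] A mA.
  by rewrite big_ord0 /= diracE mem_set// => -[].
rewrite big_ord_recl /= /lebesgue_rV_step /pushforward.
have mbox : measurable [set x : 'rV[R]_n | forall i, A (lift ord0 i) (x ord0 i)].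
  rewrite (_ : mkset _ = \bigcap_(i in [set: 'I_n])
      ((fun x : 'rV[R]_n => x ord0 i : measurableTypeR R) @^-1` A (lift ord0 i))).
    apply: fin_bigcap_measurable => // i _.
    by rewrite -[X in measurable X]setTI; exact: measurable_rV_coord.
  by apply/seteqP; split => x /= xA i; [move=> _|]; [exact: xA|exact: (xA i Logic.I)].
rewrite -(IH (A \o lift ord0))//= -product_measure1E//.
congr product_measure1; apply/seteqP; split => p /=.
- move=> pA; split; first by have := pA ord0; rewrite cons_rV0.
  by move=> i; have := pA (lift ord0 i); rewrite cons_rVS.
- move=> [p1 p2] i; have [j ->|->] := unliftP ord0 i; last by rewrite cons_rV0.
  by rewrite cons_rVS; exact: p2.
Qed.

End lebesgue_rV.
Arguments lebesgue_rV {R} n.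

Section definitions.
Context {R : realType} {d : nat}.
Implicit Types (x y xi : 'rV[R]_d) (alpha beta : R).

Definition dotp x y : R := \sum_(i < d) x ord0 i * y ord0 i.

(* The Euclidean norm; the norm `|x| of 'rV[R]_d is the sup norm. *)
Definition enorm x : R := Num.sqrt (dotp x x).

Definition symmetric_measure (nu : {measure set 'rV[R]_d -> \bar R}) : Prop :=
  forall A : set 'rV[R]_d, measurable A ->
    nu [set x : 'rV[R]_d | A (- x)] = nu A.

(* Nonnegative definiteness of a measure: \int (phi * phi~) d(gamma) >= 0,
   with phi~(x) = phi(-x), for every phi in C_c(R^d).  For a symmetric measure
   real-valued phi are enough. *)
Definition nonneg_definite (gamma : {measure set 'rV[R]_d -> \bar R}) : Prop :=
  forall phi : 'rV[R]_d -> R,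
    continuous phi -> compact (closure [set x | phi x != 0]) ->
    (0 <= \int[gamma]_x \int[lebesgue_rV d]_y (phi y * phi (y - x))%:E)%E.

(* g * gamma; it has values in \bar R because the integral need not converge
   at every y. *)
Definition conv_measure (g : 'rV[R]_d -> R)
    (gamma : {measure set 'rV[R]_d -> \bar R}) y : \bar R :=
  (\int[gamma]_x (g (y - x))%:E)%E.

(* \int |x - y|^-beta mu(dy); the inverse in \bar R gives the kernel the value
   +oo on the diagonal, where the real (0 `^ (- beta)) would be 0. *)
Definition riesz_density beta (mu : {measure set 'rV[R]_d -> \bar R}) x
    : \bar R :=
  (\int[mu]_y ((enorm (x - y) `^ beta)%:E)^-1)%E.

Definition has_density (nu : {measure set 'rV[R]_d -> \bar R})
    (h : 'rV[R]_d -> \bar R) : Prop :=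
  forall A : set 'rV[R]_d, measurable A ->
    nu A = (\int[lebesgue_rV d]_(x in A) h x)%E.

(* gamma = I_{d-beta} mu. *)
Definition is_riesz_potential beta (mu gamma : {measure set 'rV[R]_d -> \bar R})
    : Prop :=
  (0 < beta < d%:R /\ has_density gamma (riesz_density beta mu)) \/
  (beta = d%:R /\ forall A : set 'rV[R]_d, measurable A -> gamma A = mu A).

(* \int e^(-i xi.x) nu(dx), for a finite measure nu. *)
Definition fourier_transform (nu : {measure set 'rV[R]_d -> \bar R}) xi : R[i] :=
  Complex (\int[nu]_x cos (dotp xi x)) (- \int[nu]_x sin (dotp xi x)).

(* \int (lambda + |xi|^alpha)^-1 \hat gamma(dxi) < oo for some lambda > 0, for a
   finite symmetric nonnegative definite gamma: then \hat gamma is the measure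
   whose density, real and nonnegative, is [fourier_transform gamma].  The
   normalization of the Fourier transform does not affect the condition. *)
Definition dalang_condition alpha (gamma : {measure set 'rV[R]_d -> \bar R})
    : Prop :=
  exists2 lambda : R, 0 < lambda &
    (\int[lebesgue_rV d]_xi
       (complex.Re (fourier_transform gamma xi)
          / (lambda + enorm xi `^ alpha))%:E < +oo)%E.

Definition assumption_A alpha beta
    (mu : {finite_measure set 'rV[R]_d -> \bar R})
    (gamma : {measure set 'rV[R]_d -> \bar R}) : Prop :=
  [/\ 0 < beta <= d%:R,
      symmetric_measure mu,
      is_riesz_potential beta mu gamma
    & [\/ beta < Num.min alpha d%:R,
          [/\ beta = d%:R, d = 1%N & 1 < alpha]
        | [/\ beta = d%:R, alpha <= d%:R
            & exists h : 'rV[R]_d -> R,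
                [/\ forall x, 0 <= h x,
                    has_density gamma (EFin \o h)
                  & exists r : R,
                      [/\ d%:R / alpha < r,
                          h \in Lfun (lebesgue_rV d) r%:E
                        & 2 < r -> dalang_condition alpha gamma]]]]].

End definitions.

(* Main.v *)
Require Import Defs.
From HB Require Import structures.
From mathcomp Require Import all_boot all_order all_algebra.
From mathcomp Require Import complex.
From mathcomp Require Import all_classical all_reals all_analysis.
From mathcomp Require Import measurable_realfun ring lra.

Set Implicit Arguments.
Unset Strict Implicit.
Unset Printing Implicit Defensive.

Import Order.TTheory GRing.Theory Num.Theory.
Import numFieldNormedType.Exports.

Local Open Scope classical_set_scope.
Local Open Scope ring_scope.

(* In cases (i) and (iii), gamma has density \int k(x - z) mu(dz) with k in weak
   L^r (for the Riesz kernel r = d / beta, in case (iii) z = 0 and k is the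
   L^r density), and the estimate is the diagonal Hardy-Littlewood-Sobolev
   inequality with 2q = p = 2r / (2r - 1), proved as follows.
   Normalize ||f||_p = ||g||_p = 1.  By symmetry it is enough to integrate over
   g(y) <= f(x).  Fix x, put s = f(x) and cut the kernel at height
   l = s^(p / r): where k > l use g(y) <= s, and where k <= l use
   s g(y) k <= (s g(y))^p + k^(2r), p and 2r being conjugate exponents.  The weak
   L^r bound on k turns the integral in y of both parts into a multiple of s^p,
   which is integrable in x.
   In case (ii) one takes 2q = 2 and uses the Cauchy-Schwarz inequality.
   The exponent 2r / (2r - 1) lies in the required range as soon as r >= 1 and
   r > d / alpha. *)

(** * Real powers *)

Section real_powers.
Context (R : realType).
Implicit Types a b r : R.

Lemma powR_lt1 a : a < 0 -> (2 : R) `^ a < 1.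
Proof.
move=> a0; rewrite -[ltRHS](powRr0 2).
by rewrite /powR pnatr_eq0/= ltr_expR ltr_pM2r ?ln_gt0 ?ltr1n.
Qed.

Lemma young_prod a b r : 0 <= a -> 0 <= b -> 1 < r ->
  a * b <= a `^ (2 * r / (2 * r - 1)) + b `^ (2 * r).
Proof.
move=> a0 b0 r1.
have p0 : 0 < 2 * r / (2 * r - 1) by apply: divr_gt0; lra.
have p1 : 1 <= 2 * r / (2 * r - 1) by rewrite ler_pdivlMr; lra.
apply: (le_trans (@conjugate_powR R a b _ (2 * r) a0 b0 p0 _ _)).
- by lra.
- by field; apply/andP; split; apply/eqP; lra.
- apply: lerD; rewrite ler_pdivrMr// ?ler_peMr// ?powR_ge0//; lra.
Qed.

(** Passage to the limit [t -> 0]: an estimate proved for strictly positive bounds on the norms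
    extends to bounds that may vanish. *)
Lemma le_mulr_perturb (X : \bar R) (C : R) a b :
  0 <= C -> 0 <= a -> 0 <= b ->
  (forall t, 0 < t -> (X <= (C * (a + t) * (b + t))%:E)%E) ->
  (X <= (C * a * b)%:E)%E.
Proof.
move=> C0 a0 b0 H; apply/lee_addgt0Pr => e e0.
(* For [t <= 1] the excess [C (a + t) (b + t) - C a b] is at most [t D]. The choice of [t] below
   ensures both [t <= 1] and [t D <= e], even when [D = 0]. *)
pose D := C * (a + b + 1).
have D0 : 0 <= D by rewrite mulr_ge0// addr_ge0// addr_ge0.
pose t := e / (D + e).
have De : 0 < D + e by lra.
have t0 : 0 < t by rewrite divr_gt0.
have t1 : t <= 1 by rewrite ler_pdivrMr//; lra.
have tD : t * D <= e.
  by rewrite /t mulrAC ler_pdivrMr// ler_pM2l//; lra.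
apply: (le_trans (H t t0)).
rewrite -EFinD lee_fin; apply: le_trans (_ : C * a * b + t * D <= _); last lra.
rewrite -subr_ge0 (_ : _ - _ = C * (t * (1 - t))); last by rewrite /D; ring.
apply: mulr_ge0 => //; apply: mulr_ge0; rewrite ?subr_ge0//; exact: ltW.
Qed.

(** Relative to [s^p], the three summands account for the region [k > l], for the term [(s g)^p],
    and for the term [k^(2r)] where [k <= l]. The inverses are sums of geometric series of ratios
    [2^(1-r)] and [2^(-r)]. *)
Definition weak_young_cst (A : R) r : R :=
  A * (2 * (1 - 2 `^ (1 - r))^-1) + 1 +
   A * (2 `^ r * (1 - 2 `^ (- r))^-1).

Lemma weak_young_cst_ge0 (A : R) r :
  0 <= A -> 1 < r -> 0 <= weak_young_cst A r.
Proof.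
move=> A0 r1; have q0 (a : R) : a < 0 -> 0 <= (1 - 2 `^ a)^-1.
  by move=> a0; rewrite invr_ge0 subr_ge0 ltW// powR_lt1.
apply: addr_ge0; first apply: addr_ge0 => //; apply: mulr_ge0 => //;
  apply: mulr_ge0; rewrite ?powR_ge0//; apply: q0; lra.
Qed.

Lemma measurable_EFin_powR d (T : measurableType d) (f : T -> R) r :
  measurable_fun setT f -> measurable_fun setT (fun x => (f x `^ r)%:E).
Proof.
move=> mf; apply/measurable_EFinP.
exact: (measurableT_comp (measurable_powR r) mf).
Qed.

End real_powers.

(** * Invariance of Lebesgue measure on R^d *)

Section lebesgue_reflection.
Context {R : realType}.
Local Open Scope ereal_scope.

Lemma measurable_subl (c : R) :
  measurable_fun setT
    (fun x : measurableTypeR R => (c - x)%R : measurableTypeR R).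
Proof. exact: measurable_funB. Qed.

(** Lebesgue measure is determined by its values on half-open intervals, so the image measure need
    only be compared with it there. *)
Lemma lebesgue_measure_subl (c : R) (A : set (measurableTypeR R)) :
  measurable A ->
  lebesgue_measure A = lebesgue_measure [set x | A (c - x)%R].
Proof.
pose phi (x : measurableTypeR R) : measurableTypeR R := (c - x)%R.
have mphi : measurable_fun setT phi by exact: measurable_subl.
pose phiM : {mfun measurableTypeR R >-> measurableTypeR R} :=
  HB.pack phi (isMeasurableFun.Build _ _ _ _ _ mphi).
apply: (@lebesgue_measure_unique R
  (pushforward lebesgue_measure phiM)) => X [[a b] /= _ <-].
(* The reflection moves the closed endpoint from the right to the left, which does not affect the
   length. *)
rewrite /pushforward /= (_ : phi @^-1` _ = `[c - b, c - a[%classic)%R.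
  rewrite !lebesgue_measure_itv/= !lte_fin ltrD2l ltrN2; case: ifPn => // _.
  by rewrite -!EFinD; congr EFin; ring.
apply/seteqP; split => x /=; rewrite /phi !in_itv/=; lra.
Qed.

Lemma ge0_integral_lebesgue_subl (c : R) (f : measurableTypeR R -> \bar R) :
  measurable_fun setT f -> (forall x, 0 <= f x) ->
  \int[lebesgue_measure]_x f (c - x)%R = \int[lebesgue_measure]_x f x.
Proof.
move=> mf f0.
have mphi : measurable_fun setT
    (fun x : measurableTypeR R => (c - x)%R : measurableTypeR R).
  exact: measurable_subl.
pose phiM : {mfun measurableTypeR R >-> measurableTypeR R} :=
  HB.pack (fun x : measurableTypeR R => (c - x)%R : measurableTypeR R)
   (isMeasurableFun.Build _ _ _ _ _ mphi).
transitivity (\int[pushforward lebesgue_measure phiM]_x f x).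
  by rewrite (ge0_integral_pushforward mphi)// preimage_setT.
rewrite [RHS](eq_measure_integral (pushforward lebesgue_measure phiM))//.
by move=> A mA _; exact: (lebesgue_measure_subl c mA).
Qed.

Lemma measurable_rV_subl d (T : measurableType d) n (c : 'rV[R]_n)
    (f : T -> 'rV[R]_n) :
  measurable_fun setT f -> measurable_fun setT (fun x => c - f x)%R.
Proof.
move=> mf; apply: measurable_fun_rV => i.
under eq_fun do rewrite !mxE.
apply: measurable_funB => //.
exact: (measurableT_comp (@measurable_rV_coord R n i) mf).
Qed.

Lemma measurable_rV_sub d (T : measurableType d) n (f g : T -> 'rV[R]_n) :
  measurable_fun setT f -> measurable_fun setT g ->
  measurable_fun setT (fun x => f x - g x)%R.
Proof.
move=> mf mg; apply: measurable_fun_rV => i.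
under eq_fun do rewrite !mxE.
by apply: measurable_funB;
  apply: (measurableT_comp (@measurable_rV_coord R n i)).
Qed.

(** Induction on the dimension: Tonelli separates the first coordinate, treated by the
    one-dimensional case, from the others, treated by the induction hypothesis. The map [x -> c - x]
    is the substitution that a convolution calls for, and applying it twice gives the
    translations. *)
Lemma ge0_integral_lebesgue_rV_subl n (c : 'rV[R]_n) (f : 'rV[R]_n -> \bar R) :
  measurable_fun setT f -> (forall x, 0 <= f x) ->
  \int[lebesgue_rV n]_x f (c - x)%R = \int[lebesgue_rV n]_x f x.
Proof.
elim: n c f => [|n IH] c f mf f0.
  by apply: eq_integral => x _; rewrite !thinmx0.
have mcf : measurable_fun setT (fun x : 'rV[R]_n.+1 => f (c - x)%R).
  apply: measurableT_comp => //.
  exact: (measurable_rV_subl _ (@measurable_id _ _ setT)).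
rewrite /= /lebesgue_rV_step.
rewrite !ge0_integral_pushforward//; [|exact: measurable_cons_rV..].
have mcons := @measurable_cons_rV R n.
rewrite !preimage_setT fubini_tonelli1; last 2 first.
- exact: measurableT_comp.
- by move=> x; exact: f0.
rewrite fubini_tonelli1; last 2 first.
- exact: measurableT_comp.
- by move=> x; exact: f0.
rewrite /fubini_F.
pose h (a : measurableTypeR R) : \bar R := \int[lebesgue_rV n]_v f (cons_rV (a, v)).
have mh : measurable_fun setT h.
  apply: (measurable_fun_fubini_tonelli_F (f \o @cons_rV R n)).
  - exact: measurableT_comp.
  - by move=> x; exact: f0.
have h0 a : 0 <= h a by exact: integral_ge0.
apply: (etrans _ (ge0_integral_lebesgue_subl (c ord0 ord0) mh h0)).
apply: eq_integral => a _.
pose u (v : 'rV[R]_n) : \bar R := f (cons_rV (c ord0 ord0 - a, v)%R).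
have mu : measurable_fun setT u.
  exact: (measurableT_comp mf (measurableT_comp mcons (pair1_measurable _))).
have u0 v : 0 <= u v by exact: f0.
apply: (etrans _ (IH (\row_j c ord0 (lift ord0 j))%R u mu u0)).
apply: eq_integral => v _ /=; congr f; apply/rowP => i.
rewrite [LHS]mxE [in LHS]mxE; have [j ->|->] := unliftP ord0 i.
  by rewrite !cons_rVS/= !mxE.
by rewrite !cons_rV0.
Qed.

End lebesgue_reflection.

(** * Weak-type kernels *)

Section weak_type.
Context d (T : measurableType d) (R : realType).
Variable m : {measure set T -> \bar R}.
Local Open Scope ereal_scope.

(** A weak [L^r] bound, where [A] stands for the [r]-th power of the quasi-norm. The kernel is
    extended-real valued because the Riesz kernel is [+oo] at the origin. *)
Definition weak_type (A r : R) (k : T -> \bar R) :=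
  forall l : R, (0 < l)%R -> m [set y | l%:E < k y] <= (A * l `^ (- r))%:E.

(** Since [x] may be [+oo], it is compared with [y] through the real levels below it. *)
Lemma le_ereal_EFin_lt (x y : \bar R) :
  0 <= y -> (forall b : R, (0 <= b)%R -> b%:E < x -> b%:E <= y) -> x <= y.
Proof.
move=> y0 H; rewrite leNgt; apply/negP => yx.
have : y \is a fin_num by rewrite ge0_fin_numE// (lt_le_trans yx)// leey.
move: y y0 H yx => [y| |]// + H + _; rewrite lee_fin => y0 yx.
suff [b [yb bx]] : exists b : R, (y < b)%R /\ b%:E < x.
  by have := H b (ltW (le_lt_trans y0 yb)) bx; rewrite lee_fin leNgt yb.
move: x yx {H} => [x| |]//; rewrite ?lte_fin => yx.
  by exists ((x + y) / 2)%R; rewrite lte_fin; split; lra.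
by exists (y + 1)%R; rewrite ltry; split => //; lra.
Qed.

(* [a] and [t] describe a decomposition of [phi] over level sets of [k]:
   [phi <= \sum_j a_j 1_{k > t_j}]. *)
Lemma weak_type_integral_series (k phi : T -> \bar R) (a t : nat -> R)
    (A B q r : R) :
  measurable_fun setT k -> measurable_fun setT phi ->
  (forall y, 0 <= phi y) -> (0 <= A)%R -> weak_type A r k ->
  (0 <= B)%R -> (0 < q < 1)%R ->
  (forall j, 0 < t j)%R -> (forall j, 0 <= a j)%R ->
  (forall j, a j * t j `^ (- r) <= B * q ^+ j)%R ->
  (forall y (b : R), (0 <= b)%R -> b%:E < phi y ->
     exists j, (b <= a j)%R /\ (t j)%:E < k y) ->
  \int[m]_y phi y <= (A * (B * (1 - q)^-1))%:E.
Proof.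
move=> mk mphi phi0 A0 wk B0 /andP[q0 q1] t0 a0 aB H.
pose E j := [set y | (t j)%:E < k y].
have mE j : measurable (E j).
  by rewrite -[X in measurable X]setTI; exact: emeasurable_fun_o_infty.
pose F j y := (a j * \1_(E j) y)%:E.
have F0 j y : 0 <= F j y by rewrite lee_fin mulr_ge0.
have mF j : measurable_fun setT (F j).
  apply/measurable_EFinP; apply: measurable_funM => //.
(* For each real [b] below [phi y], a single term of the series is already at least [b]. *)
have phiF y : phi y <= \sum_(j <oo) F j y.
  apply: le_ereal_EFin_lt; first by apply: nneseries_ge0 => n _ _; exact: F0.
  move=> b b0 /(H _ _ b0)[j [baj tjk]].
  apply: (@le_trans _ _ (F j y)).
    by rewrite /F indicE mem_set//= mulr1 lee_fin.
  rewrite (@nneseriesD1 _ _ j)//; first by rewrite leeDl// nneseries_ge0.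
apply: (@le_trans _ _ (\int[m]_y \sum_(j <oo) F j y)).
  apply: ge0_le_integral => //.
  by apply: ge0_emeasurable_sum.
rewrite integral_nneseries//.
apply: lime_le; first by apply: is_cvg_nneseries => n _ _; exact: integral_ge0.
apply: nearW => n.
(* The weak-type bound on [{k > t_j}] makes the integral of the [j]-th term at most [A B q^j]; the
   partial sums of the geometric series stay below its limit. *)
apply: (@le_trans _ _ (\sum_(0 <= j < n) (A * (B * q ^+ j))%:E)).
  apply: lee_sum => j _.
  rewrite /F; under eq_integral do rewrite EFinM.
  rewrite ge0_integralZl_EFin//; last exact/measurable_EFinP.
  rewrite integral_indic// setIT.
  apply: (@le_trans _ _ ((a j)%:E * (A * t j `^ (- r))%:E)).
    by apply: lee_pmul => //; [rewrite lee_fin|exact: wk].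
  by rewrite -EFinM lee_fin mulrCA ler_wpM2l.
rewrite sumEFin lee_fin -mulr_sumr ler_wpM2l//.
apply: geometric_le_lim => //; rewrite ger0_norm// ltW//.
Qed.

(** Dyadic layers [l 2^j < k <= l 2^(j+1)] going up from [l]. Since [r > 1], the measure of the
    layers decays faster than their height grows, with ratio [2^(1-r) < 1]. *)
Lemma weak_type_integral_gt (k : T -> \bar R) (A r l : R) :
  measurable_fun setT k -> (forall y, 0 <= k y) ->
  (0 <= A)%R -> weak_type A r k -> (1 < r)%R -> (0 < l)%R ->
  \int[m]_y (if l%:E < k y then k y else 0) <=
  (A * (2 * l `^ (1 - r) * (1 - 2 `^ (1 - r))^-1))%:E.
Proof.
move=> mk k0 A0 wk r1 l0.
apply: (@weak_type_integral_series k _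
  (fun j => 2 * (l * 2 ^+ j))%R (fun j => l * 2 ^+ j)%R A _ _ r) => //.
- apply: measurable_fun_ifT => //; exact: measurable_fun_lte.
- by move=> y; case: ifPn.
- by rewrite mulr_ge0// powR_ge0.
- by rewrite powR_gt0// powR_lt1// subr_lt0.
- by move=> j; rewrite mulr_gt0// exprn_gt0.
- by move=> j; rewrite !mulr_ge0// ?exprn_ge0// ltW.
- move=> j; rewrite -!mulrA ler_pM2l// -!powR_mulrn ?powR_ge0//.
  rewrite -powRrM powRM ?powR_ge0// ?(ltW l0)//.
  rewrite powRD; last by rewrite (gt_eqF l0) implybT.
  rewrite powRr1 ?(ltW l0)// -!mulrA ler_pM2l//.
  rewrite mulrCA ler_pM2l ?powR_gt0//.
  rewrite -powRrM -powRD; last by rewrite pnatr_eq0 implybT.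
  by rewrite le_eqVlt; apply/orP; left; apply/eqP; congr (_ `^ _)%R; ring.
- move=> y b b0; case: ifPn => [lk bk|_]; last first.
    by rewrite lte_fin ltNge b0.
  (* The layer is the least such [n]. Minimality gives [l 2^n < b < k y] when [n > 0]; for [n = 0]
     the required [l < k y] is the assumption of the case. *)
  have ex : exists n, (b <= 2 * (l * 2 ^+ n))%R.
    exists (Num.Def.archi_bound (b / l)).
    have := upper_nthrootP (leqnn (Num.Def.archi_bound (b / l))).
    rewrite ltr_pdivrMr// mulrC => bl.
    have : (0 < l * 2 ^+ Num.Def.archi_bound (b / l))%R by exact: mulr_gt0.
    by lra.
  case: (ex_minnP ex) => -[|j] bj minj.
    by exists 0%N; split => //; rewrite expr0 mulr1.
  exists j.+1; split => //.
  have : ~~ (b <= 2 * (l * 2 ^+ j))%R by apply/negP => /minj; rewrite ltnn.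
  rewrite -ltNge => jb; apply: le_lt_trans bk; rewrite lee_fin exprS ltW//.
  by rewrite mulrCA.
Qed.

(** Dyadic layers [l 2^-(j+1) < k <= l 2^-j] going down from [l]. The power [2r] outweighs the
    growth of order [r] of the level sets and leaves the ratio [2^-r]. *)
Lemma weak_type_integral_le (k : T -> \bar R) (A r l : R) :
  measurable_fun setT k -> (forall y, 0 <= k y) ->
  (0 <= A)%R -> weak_type A r k -> (1 < r)%R -> (0 < l)%R ->
  \int[m]_y (if k y <= l%:E then (fine (k y) `^ (2 * r))%:E else 0) <=
  (A * (2 `^ r * l `^ r * (1 - 2 `^ (- r))^-1))%:E.
Proof.
move=> mk k0 A0 wk r1 l0.
have r0 : (0 < r)%R by rewrite (lt_trans _ r1).
have h0 j : (0 < l * 2^-1 ^+ j)%R by rewrite mulr_gt0// exprn_gt0// invr_gt0.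
apply: (@weak_type_integral_series k _
  (fun j => (l * 2^-1 ^+ j) `^ (2 * r))%R (fun j => l * 2^-1 ^+ j.+1)%R
  A _ _ r) => //.
- apply: measurable_fun_ifT => //; first exact: measurable_fun_lee.
  by apply: measurable_EFin_powR; exact: measurableT_comp.
- by move=> y; case: ifPn => // _; rewrite lee_fin powR_ge0.
- by rewrite mulr_ge0// powR_ge0.
- by rewrite powR_gt0// powR_lt1// oppr_lt0.
- by move=> j; rewrite powR_ge0.
- move=> j; rewrite -!powR_mulrn ?powR_ge0// ?invr_ge0//.
  rewrite -(powR_inv1 (ler0n _ 2)) -!powRrM !powRM ?powR_ge0// ?(ltW l0)//.
  rewrite -!powRrM mulrACA -!powRD ?(gt_eqF l0) ?pnatr_eq0 ?implybT//.
  rewrite [leRHS]mulrAC -powRD ?pnatr_eq0 ?implybT// [leRHS]mulrC.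
  rewrite le_eqVlt; apply/orP; left; apply/eqP; congr (_ `^ _ * _ `^ _)%R.
    by ring.
  by rewrite -natr1; ring.
- move=> y b b0; case: ifPn => [|_]; last by rewrite lte_fin ltNge b0.
  move: (k0 y); case: (k y) => [x| |]//; rewrite !lee_fin/= => x0 xl bx.
  (* At [x = 0] the power [x^(2r)] is 0 and cannot exceed [b >= 0]. Positivity is what makes some
     level [l 2^-(n+1)] fall below [x]. *)
  have {}x0 : (0 < x)%R.
    rewrite lt_neqAle x0 andbT; apply/eqP => xE; move: bx.
    by rewrite -xE powR0 ?mulf_neq0 ?gt_eqF// lte_fin ltNge b0.
  have ex : exists n, (l * 2^-1 ^+ n.+1 < x)%R.
    exists (Num.Def.archi_bound (l / x)).
    have := upper_nthrootP (leqnSn (Num.Def.archi_bound (l / x))).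
    by rewrite ltr_pdivrMr// mulrC -ltr_pdivrMr ?exprn_gt0// exprVn.
  (* Minimality of [j] gives [x <= l 2^-j]; for [j = 0] this is the assumption [x <= l]. *)
  exists (ex_minn ex).
  case: (ex_minnP ex) => j jx minj; split; last by rewrite lte_fin.
  rewrite lte_fin in bx.
  have r2 : (0 <= 2 * r)%R by rewrite mulr_ge0// ltW.
  rewrite (le_trans (ltW bx))//; apply: ge0_ler_powR => //;
    rewrite ?nnegrE ?(ltW x0) ?(ltW (h0 _))//.
  case: j jx minj => [|j] jx minj; first by rewrite expr0 mulr1.
  by rewrite leNgt; apply/negP => /minj; rewrite ltnn.
Qed.

End weak_type.

(** * The Hardy-Littlewood-Sobolev inequality *)

Section weak_young.
Context d1 d2 (T1 : measurableType d1) (T2 : measurableType d2) (R : realType).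
Variables (m1 : {sigma_finite_measure set T1 -> \bar R})
          (m2 : {sigma_finite_measure set T2 -> \bar R}).
Local Open Scope ereal_scope.

(* The part {g <= s} of a section of the bilinear form, for s = f(x). *)
Lemma weak_young_section (s A r : R) (g : T2 -> R) (k : T2 -> \bar R) :
  (1 < r)%R -> (0 <= A)%R -> (0 <= s)%R ->
  measurable_fun setT g -> measurable_fun setT k ->
  (forall y, 0 <= g y)%R -> (forall y, 0 <= k y) -> weak_type m2 A r k ->
  \int[m2]_y (g y `^ (2 * r / (2 * r - 1)))%:E <= 1 ->
  \int[m2]_y (if (g y <= s)%R then (s * g y)%:E * k y else 0) <=
  (weak_young_cst A r * s `^ (2 * r / (2 * r - 1)))%:E.
Proof.
move=> r1 A0 s0 mg mk g0 k0 wk g1; set p := (2 * r / (2 * r - 1))%R in g1 *.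
have rr : (0 < 2 * r - 1)%R by lra.
(* The case [s = 0] is separate because the cut height would be 0, while the layer estimates require
   [l > 0]. *)
move: s0; rewrite le_eqVlt => /predU1P[<-|s0].
  rewrite integral0_eq; last by move=> y _; rewrite mul0r mul0e; case: ifPn.
  by rewrite lee_fin mulr_ge0 ?powR_ge0 ?weak_young_cst_ge0.
(* With this height [l^r = s^p], and [s^2 l^(1-r) = s^p] because [p (2r - 1) = 2r]: both regions
   contribute a multiple of [s^p]. *)
pose l : R := (s `^ (p / r))%R.
have l0 : (0 < l)%R by rewrite powR_gt0.
have lr : (l `^ r = s `^ p)%R.
  by rewrite /l -powRrM; congr (_ `^ _)%R; rewrite divfK// gt_eqF//; lra.
have slr : (s ^+ 2 * l `^ (1 - r) = s `^ p)%R.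
  rewrite /l -powRrM -powR_mulrn ?(ltW s0)// -powRD ?(gt_eqF s0) ?implybT//.
  congr (_ `^ _)%R; rewrite /p; field.
  by apply/andP; split; apply/eqP; lra.
pose phi1 y := if l%:E < k y then k y else 0.
pose phi2 y := if k y <= l%:E then (fine (k y) `^ (2 * r))%:E else 0.
have mphi1 : measurable_fun setT phi1.
  by apply: measurable_fun_ifT => //; exact: measurable_fun_lte.
have mphi2 : measurable_fun setT phi2.
  apply: measurable_fun_ifT => //; first exact: measurable_fun_lee.
  by apply: measurable_EFin_powR; exact: measurableT_comp.
have phi1_ge0 y : 0 <= phi1 y by rewrite /phi1; case: ifPn.
have phi2_ge0 y : 0 <= phi2 y.
  by rewrite /phi2; case: ifPn => // _; rewrite lee_fin powR_ge0.
have mgp : measurable_fun setT (fun y => (g y `^ p)%:E).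
  by apply: measurable_EFin_powR.
have gp0 y : 0 <= (g y `^ p)%:E by rewrite lee_fin powR_ge0.
(* The majorant comes from [s g k <= s^2 k] where [k > l], and from [young_prod] applied to [s g]
   and [k] where [k <= l], so that [k] is finite there. *)
apply: (@le_trans _ _ (\int[m2]_y
  ((s ^+ 2)%:E * phi1 y + (s `^ p)%:E * (g y `^ p)%:E + phi2 y))).
  apply: ge0_le_integral => //.
  - by move=> y _; case: ifPn => // _; rewrite mule_ge0// lee_fin mulr_ge0// ltW.
  - apply: measurable_fun_ifT => //.
    + exact: measurable_fun_ler.
    + apply: emeasurable_funM => //; apply/measurable_EFinP.
      exact: measurable_funM.
  - apply: emeasurable_funD => //.
    by apply: emeasurable_funD; exact: measurable_funeM.
  - move=> y _; case: ifPn => [gs|_]; last first.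
      by rewrite !adde_ge0// mule_ge0// lee_fin ?powR_ge0// exprn_ge0// ltW.
    rewrite /phi1 /phi2; case: ifPn => [lk|].
      rewrite (_ : (if _ then _ else _) = 0) ?adde0; last by rewrite leNgt lk.
      apply: (@le_trans _ _ ((s ^+ 2)%:E * k y)).
        by rewrite lee_wpmul2r// lee_fin expr2 ler_pM2l.
      by rewrite leeDl// mule_ge0// lee_fin powR_ge0.
    rewrite -leNgt => kl; rewrite kl mule0 add0e.
    move: (k0 y) kl; case: (k y) => [x| |]//= x0 _; rewrite lee_fin in x0.
    rewrite -!EFinM -EFinD lee_fin -powRM ?(ltW s0)//.
    by apply: young_prod => //; rewrite mulr_ge0// ltW.
rewrite ge0_integralD//; last 2 first.
- by move=> y _; rewrite adde_ge0// mule_ge0// lee_fin ?powR_ge0// exprn_ge0// ltW.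
- by apply: emeasurable_funD; exact: measurable_funeM.
rewrite ge0_integralD//; last 4 first.
- by move=> y _; rewrite mule_ge0// lee_fin exprn_ge0// ltW.
- exact: measurable_funeM.
- by move=> y _; rewrite mule_ge0// lee_fin powR_ge0.
- exact: measurable_funeM.
rewrite !ge0_integralZl_EFin ?powR_ge0 ?exprn_ge0 ?(ltW s0)//.
have i1 := weak_type_integral_gt mk k0 A0 wk r1 l0.
have i2 := weak_type_integral_le mk k0 A0 wk r1 l0.
apply: (@le_trans _ _ ((s ^+ 2)%:E *
    (A * (2 * l `^ (1 - r) * (1 - 2 `^ (1 - r))^-1))%:E + (s `^ p)%:E * 1 +
    (A * (2 `^ r * l `^ r * (1 - 2 `^ (- r))^-1))%:E)).
  apply: leeD => //; apply: leeD; apply: lee_wpmul2l => //.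
    by rewrite lee_fin exprn_ge0// ltW.
  by rewrite lee_fin powR_ge0.
rewrite mule1 -EFinM -!EFinD lee_fin lr /weak_young_cst -slr le_eqVlt.
by apply/orP; left; apply/eqP; ring.
Qed.

End weak_young.

Section weak_young_bilinear.
Context d1 d2 (T1 : measurableType d1) (T2 : measurableType d2) (R : realType).
Variables (m1 : {sigma_finite_measure set T1 -> \bar R})
          (m2 : {sigma_finite_measure set T2 -> \bar R}).
Local Open Scope ereal_scope.

(** The section estimate at [s = f x], integrated in [x]: its right-hand side is a constant times
    [f^p], whose integral is at most 1. *)
Lemma weak_young_half (A r : R) (f : T1 -> R) (g : T2 -> R)
    (k : T1 * T2 -> \bar R) :
  (1 < r)%R -> (0 <= A)%R ->
  measurable_fun setT f -> measurable_fun setT g -> measurable_fun setT k ->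
  (forall x, 0 <= f x)%R -> (forall y, 0 <= g y)%R -> (forall z, 0 <= k z) ->
  (forall x, weak_type m2 A r (fun y => k (x, y))) ->
  \int[m1]_x (f x `^ (2 * r / (2 * r - 1)))%:E <= 1 ->
  \int[m2]_y (g y `^ (2 * r / (2 * r - 1)))%:E <= 1 ->
  \int[m1]_x \int[m2]_y
    (if (g y <= f x)%R then (f x * g y)%:E * k (x, y) else 0) <=
  (weak_young_cst A r)%:E.
Proof.
move=> r1 A0 mf mg mk f0 g0 k0 wk f1 g1.
have C0 := weak_young_cst_ge0 A0 r1.
apply: (@le_trans _ _ (\int[m1]_x ((weak_young_cst A r)%:E *
  (f x `^ (2 * r / (2 * r - 1)))%:E))).
  apply: ge0_le_integral => //.
  - move=> x _; apply: integral_ge0 => y _; case: ifPn => // _.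
    by rewrite mule_ge0// lee_fin mulr_ge0.
  - apply: (measurable_fun_fubini_tonelli_F (fun z : T1 * T2 =>
      if (g z.2 <= f z.1)%R then (f z.1 * g z.2)%:E * k z else 0)).
      have mf1 : measurable_fun setT (fun z : T1 * T2 => f z.1).
        exact: measurableT_comp.
      have mg2 : measurable_fun setT (fun z : T1 * T2 => g z.2).
        exact: measurableT_comp.
      apply: measurable_fun_ifT => //; first exact: measurable_fun_ler.
      by apply: emeasurable_funM => //; apply/measurable_EFinP/measurable_funM.
    move=> z; case: ifPn => // _.
    by rewrite mule_ge0// lee_fin mulr_ge0.
  - apply: measurable_funeM; by apply: measurable_EFin_powR.
  - move=> x _; rewrite -EFinM.
    apply: weak_young_section => //.
    exact: measurableT_comp mk (pair1_measurable x).
rewrite ge0_integralZl_EFin//.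
- by rewrite -[leRHS]mule1 lee_wpmul2l.
- by move=> x _; rewrite lee_fin powR_ge0.
- by apply: measurable_EFin_powR.
Qed.

End weak_young_bilinear.

Section weak_young.
Context d1 d2 (T1 : measurableType d1) (T2 : measurableType d2) (R : realType).
Variables (m1 : {sigma_finite_measure set T1 -> \bar R})
          (m2 : {sigma_finite_measure set T2 -> \bar R}).
Local Open Scope ereal_scope.

Lemma measurable_bilinear (f : T1 -> R) (g : T2 -> R) (k : T1 * T2 -> \bar R) :
  measurable_fun setT f -> measurable_fun setT g -> measurable_fun setT k ->
  measurable_fun setT (fun z => (f z.1 * g z.2)%:E * k z).
Proof.
move=> mf mg mk; apply: emeasurable_funM => //; apply/measurable_EFinP.
by apply: measurable_funM; exact: measurableT_comp.
Qed.

(** The sets [{g <= f}] and [{f <= g}] cover the product, each giving one copy of the constant. The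
    second is the first with the variables exchanged, whence the weak-type bound in each
    variable. *)
Lemma weak_young_normalized (A r : R) (f : T1 -> R) (g : T2 -> R)
    (k : T1 * T2 -> \bar R) :
  (1 < r)%R -> (0 <= A)%R ->
  measurable_fun setT f -> measurable_fun setT g -> measurable_fun setT k ->
  (forall x, 0 <= f x)%R -> (forall y, 0 <= g y)%R -> (forall z, 0 <= k z) ->
  (forall x, weak_type m2 A r (fun y => k (x, y))) ->
  (forall y, weak_type m1 A r (fun x => k (x, y))) ->
  \int[m1]_x (f x `^ (2 * r / (2 * r - 1)))%:E <= 1 ->
  \int[m2]_y (g y `^ (2 * r / (2 * r - 1)))%:E <= 1 ->
  \int[m1]_x \int[m2]_y ((f x * g y)%:E * k (x, y)) <=
  (2 * weak_young_cst A r)%:E.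
Proof.
move=> r1 A0 mf mg mk f0 g0 k0 wk2 wk1 f1 g1.
have mf1 : measurable_fun setT (fun z : T1 * T2 => f z.1).
  exact: measurableT_comp.
have mg2 : measurable_fun setT (fun z : T1 * T2 => g z.2).
  exact: measurableT_comp.
have mF := measurable_bilinear mf mg mk.
pose F (z : T1 * T2) := (f z.1 * g z.2)%:E * k z.
have F0 z : 0 <= F z by rewrite mule_ge0// lee_fin mulr_ge0.
pose F1 (z : T1 * T2) := if (g z.2 <= f z.1)%R then F z else 0.
pose F2 (z : T1 * T2) := if (f z.1 <= g z.2)%R then F z else 0.
have F10 z : 0 <= F1 z by rewrite /F1; case: ifPn.
have F20 z : 0 <= F2 z by rewrite /F2; case: ifPn.
have mF1 : measurable_fun setT F1.
  by apply: measurable_fun_ifT => //; exact: measurable_fun_ler.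
have mF2 : measurable_fun setT F2.
  by apply: measurable_fun_ifT => //; exact: measurable_fun_ler.
have -> : \int[m1]_x \int[m2]_y ((f x * g y)%:E * k (x, y)) =
    \int[m1 \x m2]_z F z by rewrite fubini_tonelli1.
apply: (@le_trans _ _ (\int[m1 \x m2]_z (F1 z + F2 z))).
  apply: ge0_le_integral => //; first exact: emeasurable_funD.
  move=> z _; rewrite /F1 /F2.
  have [gf|/ltW fg] := leP (g z.2) (f z.1).
    by rewrite leeDl//; case: ifPn.
  by rewrite fg leeDr//; case: ifPn.
have swapk : measurable_fun setT (fun z : T2 * T1 => k (z.2, z.1)).
  apply: (measurableT_comp mk).
  by apply: measurable_fun_pair; [exact: measurable_snd|exact: measurable_fst].
rewrite ge0_integralD// mulr2n mulrDl !mul1r EFinD; apply: leeD.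
  rewrite fubini_tonelli1//.
  exact: (@weak_young_half _ _ _ _ _ m1 m2 A r f g k).
(* On [{f <= g}] the outer variable has to be that of the larger function [g], hence the other order
   of integration. *)
rewrite fubini_tonelli2//.
have H := @weak_young_half _ _ _ _ _ m2 m1 A r g f _
  r1 A0 mg mf swapk g0 f0 (fun=> k0 _) wk1 g1 f1.
apply: (le_trans _ H).
rewrite le_eqVlt; apply/orP; left; apply/eqP.
by apply: eq_integral => y _; apply: eq_integral => x _; rewrite /F2 /F/= mulrC.
Qed.

(** Homogeneity: the normalized estimate applies to [f / a] and [g / b]. Only bounds [a] and [b] on
    the norms are divided by, so the norms themselves may vanish. *)
Lemma weak_young_gt0 (A r a b : R) (f : T1 -> R) (g : T2 -> R)
    (k : T1 * T2 -> \bar R) :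
  (1 < r)%R -> (0 <= A)%R ->
  measurable_fun setT f -> measurable_fun setT g -> measurable_fun setT k ->
  (forall x, 0 <= f x)%R -> (forall y, 0 <= g y)%R -> (forall z, 0 <= k z) ->
  (forall x, weak_type m2 A r (fun y => k (x, y))) ->
  (forall y, weak_type m1 A r (fun x => k (x, y))) ->
  (0 < a)%R -> (0 < b)%R ->
  \int[m1]_x (f x `^ (2 * r / (2 * r - 1)))%:E
    <= (a `^ (2 * r / (2 * r - 1)))%:E ->
  \int[m2]_y (g y `^ (2 * r / (2 * r - 1)))%:E
    <= (b `^ (2 * r / (2 * r - 1)))%:E ->
  \int[m1]_x \int[m2]_y ((f x * g y)%:E * k (x, y)) <=
  (2 * weak_young_cst A r * a * b)%:E.
Proof.
move=> r1 A0 mf mg mk f0 g0 k0 wk2 wk1 a0 b0 fa gb.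
have scale d (T : measurableType d) (m : {measure set T -> \bar R})
    (h : T -> R) (c p : R) : measurable_fun setT h -> (forall x, 0 <= h x)%R ->
    (0 < c)%R -> \int[m]_x (h x `^ p)%:E <= (c `^ p)%:E ->
    \int[m]_x ((c^-1 * h x) `^ p)%:E <= 1.
  move=> mh h0 c0 hc.
  under eq_integral do rewrite powRM ?invr_ge0 ?(ltW c0)// EFinM.
  rewrite ge0_integralZl_EFin ?powR_ge0//; last 2 first.
  - by move=> x _; rewrite lee_fin powR_ge0.
  - by apply: measurable_EFin_powR.
  apply: (@le_trans _ _ ((c^-1 `^ p)%:E * (c `^ p)%:E)).
    by rewrite lee_wpmul2l// lee_fin powR_ge0.
  by rewrite -EFinM lee_fin -powRM ?invr_ge0 ?(ltW c0)// mulVf ?powR1// gt_eqF.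
have := @weak_young_normalized A r (fun x => a^-1 * f x)%R (fun y => b^-1 * g y)%R k
  r1 A0 (measurable_funM (measurable_cst _) mf)
  (measurable_funM (measurable_cst _) mg) mk.
move=> /(_ _ _ k0 wk2 wk1 (scale _ _ m1 _ _ _ mf f0 a0 fa)
  (scale _ _ m2 _ _ _ mg g0 b0 gb)).
have F0 z : 0 <= (f z.1 * g z.2)%:E * k z by rewrite mule_ge0// lee_fin mulr_ge0.
have mF := measurable_bilinear mf mg mk.
have -> : \int[m1]_x \int[m2]_y ((a^-1 * f x * (b^-1 * g y))%:E * k (x, y)) =
    (a^-1 * b^-1)%:E * \int[m1]_x \int[m2]_y ((f x * g y)%:E * k (x, y)).
  rewrite -ge0_integralZl_EFin ?mulr_ge0 ?invr_ge0 ?(ltW a0) ?(ltW b0)//; last 2 first.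
  - by move=> x _; apply: integral_ge0 => y _; exact: (F0 (x, y)).
  - exact: (measurable_fun_fubini_tonelli_F _ mF F0).
  apply: eq_integral => x _.
  rewrite -ge0_integralZl_EFin ?mulr_ge0 ?invr_ge0 ?(ltW a0) ?(ltW b0)//; last 2 first.
  - by move=> y _; exact: (F0 (x, y)).
  - exact: (measurableT_comp mF (pair1_measurable x)).
  by apply: eq_integral => y _; rewrite muleA -EFinM mulrACA.
rewrite -lee_pdivlMl ?mulr_gt0 ?invr_gt0//.
move=> H; apply: (le_trans (H _ _)).
- by move=> x; rewrite mulr_ge0// invr_ge0 ltW.
- by move=> x; rewrite mulr_ge0// invr_ge0 ltW.
- by rewrite -EFinM lee_fin invfM !invrK mulrC -!mulrA.
Qed.

(** The positive case at [a + t] and [b + t], followed by [t -> 0]. *)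
Lemma weak_young (A r a b : R) (f : T1 -> R) (g : T2 -> R)
    (k : T1 * T2 -> \bar R) :
  (1 < r)%R -> (0 <= A)%R ->
  measurable_fun setT f -> measurable_fun setT g -> measurable_fun setT k ->
  (forall x, 0 <= f x)%R -> (forall y, 0 <= g y)%R -> (forall z, 0 <= k z) ->
  (forall x, weak_type m2 A r (fun y => k (x, y))) ->
  (forall y, weak_type m1 A r (fun x => k (x, y))) ->
  (0 <= a)%R -> (0 <= b)%R ->
  \int[m1]_x (f x `^ (2 * r / (2 * r - 1)))%:E
    <= (a `^ (2 * r / (2 * r - 1)))%:E ->
  \int[m2]_y (g y `^ (2 * r / (2 * r - 1)))%:E
    <= (b `^ (2 * r / (2 * r - 1)))%:E ->
  \int[m1]_x \int[m2]_y ((f x * g y)%:E * k (x, y)) <=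
  (2 * weak_young_cst A r * a * b)%:E.
Proof.
move=> r1 A0 mf mg mk f0 g0 k0 wk2 wk1 a0 b0 fa gb.
have p0 : (0 <= 2 * r / (2 * r - 1))%R by apply: divr_ge0; lra.
have C0 : (0 <= 2 * weak_young_cst A r)%R by rewrite mulr_ge0// weak_young_cst_ge0.
set C := (2 * weak_young_cst A r)%R in C0 *.
apply: le_mulr_perturb => // t t0; apply: weak_young_gt0 => //; rewrite ?ltr_wpDl//.
  apply: (le_trans fa); rewrite lee_fin ge0_ler_powR// ?nnegrE; lra.
apply: (le_trans gb); rewrite lee_fin ge0_ler_powR// ?nnegrE; lra.
Qed.

End weak_young.

(** * Convolution with a measure *)

Section integral_density.
Context d (T : measurableType d) (R : realType).
Variables (m nu : {measure set T -> \bar R}) (h : T -> \bar R).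
Hypotheses (mh : measurable_fun setT h) (h0 : forall x, (0 <= h x)%E).
Hypothesis nuh : forall A, measurable A -> nu A = (\int[m]_(x in A) h x)%E.
Local Open Scope ereal_scope.

Import HBNNSimple.

Let integral_density_nnsfun (f : {nnsfun T >-> R}) :
  \int[nu]_x (f x)%:E = \int[m]_x ((f x)%:E * h x).
Proof.
transitivity (\int[nu]_x
   (\sum_(y \in range f) (y * \1_(f @^-1` [set y]) x)%:E)).
  by apply: eq_integral => t _; rewrite /= fimfunE -fsumEFin.
have indich r : measurable_fun setT (fun x => (r * \1_(f @^-1` [set r]) x)%:E).
  by apply: (measurable_comp measurableT) => //; exact: measurable_funM.
rewrite ge0_integral_fsum//; last by move=> y x _; exact: nnfun_muleindic_ge0.
transitivity (\int[m]_x (\sum_(y \in range f)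
    (y * \1_(f @^-1` [set y]) x)%:E * h x)); last first.
  apply: eq_integral => x _.
  rewrite -ge0_mule_fsuml => [|y]; last exact: nnfun_muleindic_ge0.
  by rewrite fsumEFin // -(fimfunE _ x).
rewrite ge0_integral_fsum//; last 2 first.
- by move=> y; exact: emeasurable_funM.
- by move=> y x _; rewrite mule_ge0// nnfun_muleindic_ge0.
apply: eq_fsbigr => r; rewrite inE => -[t _ frt].
have r0 : (0 <= r)%R by rewrite -frt.
have mE : measurable (f @^-1` [set r]) by exact: measurable_sfunP.
under [LHS]eq_integral do rewrite EFinM.
under [RHS]eq_integral do rewrite EFinM -muleA.
rewrite !ge0_integralZl_EFin//; last 3 first.
- by move=> x _; rewrite mule_ge0// lee_fin.
- apply: emeasurable_funM => //; exact/measurable_EFinP.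
- exact/measurable_EFinP.
rewrite integral_indic// setIT nuh// [in LHS]integral_mkcond.
congr (_ * _); apply: eq_integral => x _.
by rewrite epatch_indic/= muleC.
Qed.

(** The two sides agree on simple functions, and monotone convergence along simple functions
    increasing to [f] extends this. The density may take the value [+oo]. *)
Lemma ge0_integral_density (f : T -> \bar R) :
  measurable_fun setT f -> (forall x, 0 <= f x) ->
  \int[nu]_x f x = \int[m]_x (f x * h x).
Proof.
move=> mf f0; pose g := nnsfun_approx measurableT mf.
have gE x : (g n x)%:E @[n --> \oo] --> f x.
  by apply: cvg_nnsfun_approx => // y _; exact: f0.
have ghE x : (g n x)%:E * h x @[n --> \oo] --> f x * h x.
  (* Multiplication by h x = +oo is not continuous at 0. *)
  have [hx|] := boolP (h x \is a fin_num); first exact: cvgeZr.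
  rewrite ge0_fin_numE// -leNgt leye_eq => /eqP hx; rewrite hx.
  have [fx0|fx0] := eqVneq (f x) 0.
    rewrite fx0 mul0e; apply: cvg_near_cst; apply: nearW => n.
    suff -> : g n x = 0%R by rewrite mul0e.
    have : (g n x)%:E <= f x by rewrite /g nnsfun_approxE le_approx.
    by rewrite fx0 lee_fin => gn0; apply/le_anti; rewrite gn0 fun_ge0.
  have {}fx0 : 0 < f x by rewrite lt0e fx0 f0.
  rewrite gt0_muley//; apply: cvg_near_cst.
  have : \forall n \near \oo, 0 < (g n x)%:E by exact: (gE x _ (open_ereal_gt' fx0)).
  by apply: filterS => n gn; rewrite gt0_muley.
transitivity (limn (fun n => \int[nu]_x (g n x)%:E)).
  rewrite -monotone_convergence//.
  - by apply: eq_integral => x _; apply/esym/cvg_lim.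
  - by move=> n; exact/measurable_EFinP.
  - by move=> n x _; rewrite lee_fin.
  - by move=> x _ a b ab; rewrite lee_fin; exact/lefP/nd_nnsfun_approx.
under eq_fun do rewrite integral_density_nnsfun.
rewrite -monotone_convergence//.
- by apply: eq_integral => x _; apply/cvg_lim.
- by move=> n; apply: emeasurable_funM => //; exact/measurable_EFinP.
- by move=> n x _; rewrite mule_ge0// lee_fin.
- move=> x _ a b ab; rewrite lee_wpmul2r// lee_fin.
  exact/lefP/nd_nnsfun_approx.
Qed.

End integral_density.

(** * From bounds on nonnegative functions to signed functions in [L^p] *)

Section convolution_form.
Context (R : realType) (d : nat).
Variables (gamma : {measure set 'rV[R]_d -> \bar R}) (p C : R).
Local Open Scope ereal_scope.
Local Notation L := (@lebesgue_rV R d).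

(** Tonelli gives this property for a sigma-finite measure; [gamma] is not given as one, so the
    property is isolated and established in each case. *)
Definition measurable_convolution :=
  forall u : 'rV[R]_d -> \bar R, measurable_fun setT u -> (forall x, 0 <= u x) ->
    measurable_fun setT (fun y : 'rV[R]_d => \int[gamma]_x u (y - x)%R).

(** The estimate for nonnegative functions, with [a] and [b] as upper bounds for the [L^p] norms, so
    that it involves only integrals of [p]-th powers. *)
Definition bounded_convolution_form :=
  forall (f g : 'rV[R]_d -> R) (a b : R),
    measurable_fun setT f -> measurable_fun setT g ->
    (forall x, 0 <= f x)%R -> (forall x, 0 <= g x)%R -> (0 <= a)%R -> (0 <= b)%R ->
    \int[L]_x (f x `^ p)%:E <= (a `^ p)%:E ->
    \int[L]_x (g x `^ p)%:E <= (b `^ p)%:E ->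
    \int[L]_y ((f y)%:E * \int[gamma]_x (g (y - x)%R)%:E) <= (C * a * b)%:E.

Hypotheses (p0 : (0 < p)%R) (mconv : measurable_convolution)
  (bconv : bounded_convolution_form).

Lemma Lfun_powR_Lnorm (f : 'rV[R]_d -> R) : f \in Lfun L p%:E ->
  [/\ measurable_fun setT f, 'N[L]_p%:E[EFin \o f] \is a fin_num &
    \int[L]_x (`|f x| `^ p)%:E = (fine ('N[L]_p%:E[EFin \o f]) `^ p)%:E].
Proof.
move=> /[dup] /sub_Lfun_mfun; rewrite inE/= => mf /sub_Lfun_finLfun.
rewrite inE/= /finite_norm => fp.
have Nfin : 'N[L]_p%:E[EFin \o f] \is a fin_num.
  by rewrite ge0_fin_numE; [exact: fp|exact: Lnorm_ge0].
by split => //; rewrite -poweR_EFin fineK// poweR_Lnorm ?gt_eqF.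
Qed.

Lemma measurable_shift_subl (g : 'rV[R]_d -> R) (y : 'rV[R]_d) :
  measurable_fun setT g ->
  measurable_fun setT (fun x : 'rV[R]_d => (g (y - x)%R)%:E).
Proof.
move=> mg; apply/measurable_EFinP; apply: measurableT_comp => //.
exact: (measurable_rV_subl y (@measurable_id _ _ setT)).
Qed.

Lemma integral_Lfun_conv_le (f g : 'rV[R]_d -> R) :
  f \in Lfun L p%:E -> g \in Lfun L p%:E ->
  \int[L]_y (`|f y|%:E * \int[gamma]_x `|g (y - x)%R|%:E) <=
  C%:E * 'N[L]_p%:E[EFin \o f] * 'N[L]_p%:E[EFin \o g].
Proof.
move=> /Lfun_powR_Lnorm[mf Nf fE] /Lfun_powR_Lnorm[mg Ng gE].
rewrite -(fineK Nf) -(fineK Ng) -!EFinM.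
apply: (@bconv (fun y : 'rV[R]_d => `|f y|)%R (fun y : 'rV[R]_d => `|g y|)%R) => //.
- exact: measurableT_comp.
- exact: measurableT_comp.
- exact/fine_ge0/Lnorm_ge0.
- exact/fine_ge0/Lnorm_ge0.
- by rewrite fE.
- by rewrite gE.
Qed.

Lemma measurable_conv_abs (g : 'rV[R]_d -> R) : measurable_fun setT g ->
  measurable_fun setT (fun y : 'rV[R]_d => \int[gamma]_x `|g (y - x)%R|%:E).
Proof.
move=> mg; apply: (mconv (u := fun x : 'rV[R]_d => `|g x|%:E)) => //.
by apply/measurable_EFinP; exact: measurableT_comp.
Qed.

(** The integral is the difference of those of the positive and negative parts at every [y],
    including those where it does not converge. *)
Lemma measurable_conv_measure (g : 'rV[R]_d -> R) : measurable_fun setT g ->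
  measurable_fun setT (conv_measure g gamma).
Proof.
move=> mg; have mEg : measurable_fun setT (EFin \o g) by exact/measurable_EFinP.
rewrite (_ : conv_measure g gamma = fun y : 'rV[R]_d =>
  \int[gamma]_x (EFin \o g)^\+ (y - x)%R - \int[gamma]_x (EFin \o g)^\- (y - x)%R).
  by apply: emeasurable_funB; apply: mconv => //;
    [exact: measurable_funepos|exact: measurable_funeneg].
apply/funext => y; rewrite /conv_measure integralE.
by congr (_ - _); apply: eq_integral => x _; rewrite ?funeposE ?funenegE.
Qed.

(** Testing the form with the indicator of a set of finite measure shows that the convolution of
    [|g|] is integrable on that set, hence finite almost everywhere there; countably many such sets
    cover the space. *)
Lemma ae_integrable_shift (g : 'rV[R]_d -> R) : g \in Lfun L p%:E ->
  {ae L, forall y,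
    gamma.-integrable setT (fun x : 'rV[R]_d => (g (y - x)%R)%:E)}.
Proof.
move=> /Lfun_powR_Lnorm[mg Ng gE].
have mV := measurable_conv_abs mg.
set V := (fun y : 'rV[R]_d => _) in mV.
have V0 y : 0 <= V y by exact: integral_ge0.
have [F TF Foo] := sigma_finiteT L.
suff H n : {ae L, forall y, F n y -> V y \is a fin_num}.
  have := ae_foralln H; apply: filterS => y Hy.
  have [n _ Fny] : (\bigcup_i F i) y by rewrite -TF.
  apply/integrableP; split; first exact: measurable_shift_subl.
  by rewrite -ge0_fin_numE; [exact: Hy Fny|exact: V0].
have [mFn Fnoo] := Foo n.
have Fnfin : L (F n) \is a fin_num by rewrite ge0_fin_numE.
(* The [L^p] norm of the indicator of [F n]. *)
pose a := (fine (L (F n)) `^ p^-1)%R.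
have : \int[L]_y ((\1_(F n) y)%:E * V y) <=
    (C * a * fine ('N[L]_p%:E[EFin \o g]))%:E.
  apply: (@bconv (\1_(F n)) (fun y : 'rV[R]_d => `|g y|)%R) => //.
  - exact: measurableT_comp.
  - exact: powR_ge0.
  - exact/fine_ge0/Lnorm_ge0.
  - rewrite /a -powRrM mulVf ?gt_eqF// powRr1 ?fine_ge0// fineK//.
    rewrite le_eqVlt; apply/orP; left; apply/eqP.
    rewrite -[in RHS](setIT (F n)) -integral_indic//.
    apply: eq_integral => x _; rewrite indicE.
    by case: (x \in F n); rewrite ?powR1 ?powR0 ?gt_eqF.
  - by rewrite gE.
rewrite (_ : \int[L]_y _ = \int[L]_(y in F n) V y); last first.
  rewrite [RHS]integral_mkcond; apply: eq_integral => y _.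
  by rewrite epatch_indic/= muleC.
move=> VF; have iV : L.-integrable (F n) V.
  apply/integrableP; split; first exact: measurable_funTS.
  under eq_integral do rewrite gee0_abs//.
  by rewrite (le_lt_trans VF)// ltry.
exact: integrable_ae iV.
Qed.

(** The form evaluated at [|f|] and [|g|] dominates the integral of the absolute value, which yields
    both the integrability and the inequality. *)
Lemma bounded_convolution_formP (f g : 'rV[R]_d -> R) :
  f \in Lfun L p%:E -> g \in Lfun L p%:E ->
  [/\ {ae L, forall y,
        gamma.-integrable setT (fun x : 'rV[R]_d => (g (y - x)%R)%:E)},
      L.-integrable setT (fun y : 'rV[R]_d => (f y)%:E * conv_measure g gamma y)
    & \int[L]_y ((f y)%:E * conv_measure g gamma y) <=
      C%:E * 'N[L]_p%:E[EFin \o f] * 'N[L]_p%:E[EFin \o g]].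
Proof.
move=> fp gp; have [mf Nf _] := Lfun_powR_Lnorm fp.
have [mg Ng _] := Lfun_powR_Lnorm gp.
have mfg : measurable_fun setT
    (fun y : 'rV[R]_d => (f y)%:E * conv_measure g gamma y).
  apply: emeasurable_funM; first exact/measurable_EFinP.
  exact: measurable_conv_measure.
have abs_le : \int[L]_y `|(f y)%:E * conv_measure g gamma y| <=
    C%:E * 'N[L]_p%:E[EFin \o f] * 'N[L]_p%:E[EFin \o g].
  apply: le_trans (integral_Lfun_conv_le fp gp).
  apply: ge0_le_integral => //.
  - exact: measurableT_comp.
  - apply: emeasurable_funM; last exact: measurable_conv_abs.
    by apply/measurable_EFinP; exact: measurableT_comp.
  - move=> y _; rewrite abseM lee_wpmul2l//.
    exact: le_abse_integral (measurable_shift_subl y mg).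
split; first exact: ae_integrable_shift.
  apply/integrableP; split => //; apply: (le_lt_trans abs_le).
  by rewrite -(fineK Nf) -(fineK Ng) -!EFinM ltry.
apply: le_trans abs_le; apply: (le_trans (lee_abs _)).
exact: le_abse_integral.
Qed.

End convolution_form.

(** * Convolution forms with weak-type kernels *)

Section convolution_kernel.
Context (R : realType) (d : nat).
Local Open Scope ereal_scope.
Local Notation L := (@lebesgue_rV R d).

Lemma lebesgue_rV_subl (c : 'rV[R]_d) (E : set 'rV[R]_d) : measurable E ->
  L [set x : 'rV[R]_d | E (c - x)%R] = L E.
Proof.
move=> mE; have mE' : measurable [set x : 'rV[R]_d | E (c - x)%R].
  rewrite -[X in measurable X]setTI.
  exact: (measurable_rV_subl c (@measurable_id _ _ setT)).
rewrite -[in LHS](setIT (mkset _)) -[in RHS](setIT E) -!integral_indic//.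
rewrite -[RHS](ge0_integral_lebesgue_rV_subl c)//; last first.
- by apply/measurable_EFinP.
Qed.

Lemma weak_type_subl (A r : R) (k : 'rV[R]_d -> \bar R) (c : 'rV[R]_d) :
  measurable_fun setT k -> weak_type L A r k ->
  weak_type L A r (fun x : 'rV[R]_d => k (c - x)%R).
Proof.
move=> mk wk l l0.
rewrite -[leLHS]/(L [set x : 'rV[R]_d | [set y | l%:E < k y] (c - x)%R]).
rewrite lebesgue_rV_subl; first exact: wk.
by rewrite -[X in measurable X]setTI; exact: emeasurable_fun_o_infty.
Qed.

Lemma weak_type_subr (A r : R) (k : 'rV[R]_d -> \bar R) (c : 'rV[R]_d) :
  measurable_fun setT k -> weak_type L A r k ->
  weak_type L A r (fun x : 'rV[R]_d => k (x - c)%R).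
Proof.
move=> mk wk.
rewrite (_ : (fun x => _) = (fun x : 'rV[R]_d => k (0 - (c - x))%R)); last first.
  by apply/funext => x; rewrite sub0r opprB.
apply: (@weak_type_subl _ _ (fun x : 'rV[R]_d => k (0 - x)%R)).
  apply: measurableT_comp => //.
  exact: (measurable_rV_subl 0 (@measurable_id _ _ setT)).
exact: weak_type_subl.
Qed.

Lemma measurable_fst_sub_snd :
  measurable_fun setT (fun z : 'rV[R]_d * 'rV[R]_d => (z.1 - z.2)%R).
Proof. by apply: measurable_rV_sub; [exact: measurable_fst|exact: measurable_snd]. Qed.

(** [weak_young] for the kernel [k (y - x - z)]. The constant does not depend on the shift [z],
    which allows a later integration in [z]. *)
Lemma weak_young_convolution (A r : R) (k : 'rV[R]_d -> \bar R)
    (z : 'rV[R]_d) (f g : 'rV[R]_d -> R) (a b : R) :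
  (1 < r)%R -> (0 <= A)%R ->
  measurable_fun setT k -> (forall x, 0 <= k x) -> weak_type L A r k ->
  measurable_fun setT f -> measurable_fun setT g ->
  (forall x, 0 <= f x)%R -> (forall x, 0 <= g x)%R -> (0 <= a)%R -> (0 <= b)%R ->
  \int[L]_x (f x `^ (2 * r / (2 * r - 1)))%:E
    <= (a `^ (2 * r / (2 * r - 1)))%:E ->
  \int[L]_x (g x `^ (2 * r / (2 * r - 1)))%:E
    <= (b `^ (2 * r / (2 * r - 1)))%:E ->
  \int[L]_y ((f y)%:E * \int[L]_x ((g (y - x)%R)%:E * k (x - z)%R)) <=
  (2 * weak_young_cst A r * a * b)%:E.
Proof.
move=> r1 A0 mk k0 wk mf mg f0 g0 a0 b0 fa gb.
have mkz : measurable_fun setT (fun w : 'rV[R]_d * 'rV[R]_d => k (w.1 - w.2 - z)%R).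
  apply: (measurableT_comp mk); apply: measurable_rV_sub => //.
  exact: measurable_fst_sub_snd.
have := @weak_young _ _ _ _ R L L A r a b f g
  (fun w : 'rV[R]_d * 'rV[R]_d => k (w.1 - w.2 - z)%R) r1 A0 mf mg mkz f0 g0.
move=> /(_ (fun=> k0 _) _ _ a0 b0 fa gb) H.
apply: le_trans (H _ _).
- rewrite le_eqVlt; apply/orP; left; apply/eqP.
  apply: eq_integral => y _.
  have mgk : measurable_fun setT
      (fun x : 'rV[R]_d => (g (y - x)%R)%:E * k (x - z)%R).
    apply: emeasurable_funM; first exact: measurable_shift_subl.
    by apply: measurableT_comp => //; apply: measurable_rV_sub.
  (* The substitution [x -> y - x] turns [g (y - x) k (x - z)] into [g x k (y - x - z)]. *)
  rewrite -(ge0_integral_lebesgue_rV_subl y mgk); last first.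
    by move=> x; rewrite mule_ge0// lee_fin.
  rewrite -ge0_integralZl_EFin//; last 2 first.
  + by move=> x _; rewrite mule_ge0// lee_fin.
  + apply: (measurableT_comp mgk).
    exact: (measurable_rV_subl y (@measurable_id _ _ setT)).
  by apply: eq_integral => x _; rewrite /= subKr muleA -EFinM.
(* Fixing one variable of the kernel leaves a translate of [k], reflected here and plain in the next
   goal; both keep the weak-type constant [A]. *)
- move=> x; rewrite (_ : (fun y => _) = (fun y : 'rV[R]_d => k (x - z - y)%R)).
    exact: weak_type_subl.
  by apply/funext => y /=; rewrite addrAC.
- move=> y; rewrite (_ : (fun x => _) = (fun x : 'rV[R]_d => k (x - (y + z))%R)).
    exact: weak_type_subr.
  by apply/funext => x /=; rewrite opprD addrA.
Qed.

Lemma measurable_convolution_sigma_finite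
    (nu : {sigma_finite_measure set 'rV[R]_d -> \bar R}) :
  measurable_convolution nu.
Proof.
move=> u mfu u0; apply: (measurable_fun_fubini_tonelli_F
  (fun z : 'rV[R]_d * 'rV[R]_d => u (z.1 - z.2)%R)) => //.
by apply: measurableT_comp => //; exact: measurable_fst_sub_snd.
Qed.

Lemma integral_density_convolution (gamma : {measure set 'rV[R]_d -> \bar R})
    (rho : 'rV[R]_d -> \bar R) (u : 'rV[R]_d -> \bar R) (y : 'rV[R]_d) :
  measurable_fun setT rho -> (forall x, 0 <= rho x) -> has_density gamma rho ->
  measurable_fun setT u -> (forall x, 0 <= u x) ->
  \int[gamma]_x u (y - x)%R = \int[L]_x (u (y - x)%R * rho x).
Proof.
move=> mrho rho0 gammarho mu u0.
rewrite (ge0_integral_density mrho rho0 gammarho)//.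
apply: measurableT_comp => //.
exact: (measurable_rV_subl y (@measurable_id _ _ setT)).
Qed.

(** The density replaces [gamma] by Lebesgue measure, to which Tonelli applies. *)
Lemma measurable_convolution_density
    (gamma : {measure set 'rV[R]_d -> \bar R}) (rho : 'rV[R]_d -> \bar R) :
  measurable_fun setT rho -> (forall x, 0 <= rho x) -> has_density gamma rho ->
  measurable_convolution gamma.
Proof.
move=> mrho rho0 gammarho u mu u0.
under eq_fun do rewrite (integral_density_convolution _ mrho)//.
apply: (measurable_fun_fubini_tonelli_F
  (fun z : 'rV[R]_d * 'rV[R]_d => u (z.1 - z.2)%R * rho z.2)).
  apply: emeasurable_funM; last exact: measurableT_comp.
  by apply: measurableT_comp => //; exact: measurable_fst_sub_snd.
by move=> z; rewrite mule_ge0.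
Qed.

Lemma bounded_convolution_form_weak_type
    (gamma : {measure set 'rV[R]_d -> \bar R}) (A r : R) (k : 'rV[R]_d -> \bar R) :
  (1 < r)%R -> (0 <= A)%R ->
  measurable_fun setT k -> (forall x, 0 <= k x) -> weak_type L A r k ->
  has_density gamma k ->
  bounded_convolution_form gamma (2 * r / (2 * r - 1)) (2 * weak_young_cst A r).
Proof.
move=> r1 A0 mk k0 wk gammak f g a b mf mg f0 g0 a0 b0 fa gb.
have := weak_young_convolution 0 r1 A0 mk k0 wk mf mg f0 g0 a0 b0 fa gb.
apply: le_trans; rewrite le_eqVlt; apply/orP; left; apply/eqP.
apply: eq_integral => y _; congr (_ * _).
rewrite (integral_density_convolution _ mk k0 gammak (u := EFin \o g))//.
  by apply: eq_integral => x _; rewrite subr0.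
exact/measurable_EFinP.
Qed.

(** The density is a superposition of the translates [k (x - z)]; Tonelli moves the integration in
    [z] outside, the bound uniform in [z] applies, and [mu] contributes its total mass. *)
Lemma bounded_convolution_form_integral_weak_type
    (gamma : {measure set 'rV[R]_d -> \bar R})
    (mu : {finite_measure set 'rV[R]_d -> \bar R})
    (A r : R) (k : 'rV[R]_d -> \bar R) :
  (1 < r)%R -> (0 <= A)%R ->
  measurable_fun setT k -> (forall x, 0 <= k x) -> weak_type L A r k ->
  has_density gamma (fun x => \int[mu]_z k (x - z)%R) ->
  bounded_convolution_form gamma (2 * r / (2 * r - 1))
    (2 * weak_young_cst A r * fine (mu setT)).
Proof.
move=> r1 A0 mk k0 wk gammak f g a b mf mg f0 g0 a0 b0 fa gb.
have mrho : measurable_fun setT (fun x : 'rV[R]_d => \int[mu]_z k (x - z)%R).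
  exact: measurable_convolution_sigma_finite.
have rho0 (x : 'rV[R]_d) : 0 <= \int[mu]_z k (x - z)%R by exact: integral_ge0.
pose N (w : 'rV[R]_d * 'rV[R]_d) :=
  \int[L]_x ((g (w.1 - x)%R)%:E * k (x - w.2)%R).
have N0 w : 0 <= N w.
  by apply: integral_ge0 => x _; rewrite mule_ge0// lee_fin.
have mk2 : measurable_fun setT (fun w : 'rV[R]_d * 'rV[R]_d => k (w.1 - w.2)%R).
  by apply: measurableT_comp => //; exact: measurable_fst_sub_snd.
have m1 : measurable_fun setT
    (fun z : ('rV[R]_d * 'rV[R]_d) * 'rV[R]_d => z.1.1).
  apply: (@measurableT_comp _ _ _ _ _ _ (fun w : 'rV[R]_d * 'rV[R]_d => w.1)) => //.
    exact: measurable_fst.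
have m2 : measurable_fun setT
    (fun z : ('rV[R]_d * 'rV[R]_d) * 'rV[R]_d => z.1.2).
  apply: (@measurableT_comp _ _ _ _ _ _ (fun w : 'rV[R]_d * 'rV[R]_d => w.2)) => //.
    exact: measurable_snd.
have mN : measurable_fun setT N.
  apply: (measurable_fun_fubini_tonelli_F
    (fun z : ('rV[R]_d * 'rV[R]_d) * 'rV[R]_d =>
       (g (z.1.1 - z.2)%R)%:E * k (z.2 - z.1.2)%R)).
    apply: emeasurable_funM.
      apply/measurable_EFinP; apply: measurableT_comp => //.
      by apply: measurable_rV_sub => //; exact: measurable_snd.
    apply: (measurableT_comp mk).
    by apply: measurable_rV_sub => //; exact: measurable_snd.
  by move=> z; rewrite mule_ge0// lee_fin.
(* First exchange: [mu(dz)] is moved outside the integral in [x]. The second exchange, after this,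
   moves it outside the integral in [y]. *)
apply: (@le_trans _ _ (\int[L]_y \int[mu]_z ((f y)%:E * N (y, z)))).
  rewrite le_eqVlt; apply/orP; left; apply/eqP.
  apply: eq_integral => y _.
  rewrite (integral_density_convolution _ mrho rho0 gammak (u := EFin \o g))//;
    last first.
    exact/measurable_EFinP.
  rewrite ge0_integralZl_EFin//; last first.
    exact: measurableT_comp mN (pair1_measurable y).
  congr (_ * _).
  rewrite /N /= (fubini_tonelli (m1 := mu) (m2 := L)
    (fun z : 'rV[R]_d * 'rV[R]_d =>
     (g (y - z.2)%R)%:E * k (z.2 - z.1)%R)); last 2 first.
  - apply: emeasurable_funM.
      apply/measurable_EFinP; apply: measurableT_comp => //.
      exact: measurable_rV_subl.
    apply: (measurableT_comp mk).
    by apply: measurable_rV_sub; [exact: measurable_snd|exact: measurable_fst].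
  - by move=> z; rewrite mule_ge0// lee_fin.
  apply: eq_integral => x _ /=.
  rewrite ge0_integralZl_EFin//.
  apply: measurableT_comp => //.
  exact: (measurable_rV_subl x (@measurable_id _ _ setT)).
rewrite (fubini_tonelli (m1 := L) (m2 := mu)
  (fun z : 'rV[R]_d * 'rV[R]_d => (f z.1)%:E * N z)); last 2 first.
- apply: emeasurable_funM => //; apply/measurable_EFinP.
  exact: measurableT_comp.
- by move=> z; rewrite mule_ge0// lee_fin.
apply: (@le_trans _ _ (\int[mu]_z (cst (2 * weak_young_cst A r * a * b)%:E z))).
  apply: ge0_le_integral => //.
  - by move=> z _; apply: integral_ge0 => y _; rewrite mule_ge0// lee_fin.
  - apply: (measurable_fun_fubini_tonelli_G
      (fun z : 'rV[R]_d * 'rV[R]_d => (f z.1)%:E * N z)).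
      apply: emeasurable_funM => //; apply/measurable_EFinP.
      exact: measurableT_comp.
    by move=> z; rewrite mule_ge0// lee_fin.
  - by move=> z _; exact: weak_young_convolution.
rewrite integral_cst//.
rewrite -[X in _ * X <= _](fineK (fin_num_measure mu _ measurableT)).
by rewrite -EFinM lee_fin le_eqVlt; apply/orP; left; apply/eqP; rewrite /=; ring.
Qed.

End convolution_kernel.

(** * The Riesz kernel and its weak-type bound *)

Section riesz_kernel.
Context (R : realType) (d : nat).
Local Open Scope ereal_scope.
Local Notation L := (@lebesgue_rV R d).
Implicit Types (x : 'rV[R]_d) (beta : R).

(* Equal to +oo at the origin, as in [riesz_density]. *)
Definition riesz_kernel beta x : \bar R := ((enorm x `^ beta)%:E)^-1.

(** Outside the singularity the inverse is written as a real power, whose measurability is known. *)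
Lemma riesz_kernelE beta x : riesz_kernel beta x =
  if (enorm x `^ beta == 0)%R then +oo else ((enorm x `^ beta) `^ (-1))%:E.
Proof. by rewrite /riesz_kernel inver powR_inv1// powR_ge0. Qed.

Lemma riesz_kernel_ge0 beta x : 0 <= riesz_kernel beta x.
Proof. by rewrite riesz_kernelE; case: ifPn => // _; rewrite lee_fin powR_ge0. Qed.

Lemma measurable_enorm : measurable_fun setT (@enorm R d : 'rV[R]_d -> R).
Proof.
have dotp_ge0 x : (0 <= dotp x x)%R.
  by apply: sumr_ge0 => i _; rewrite -expr2 sqr_ge0.
rewrite (_ : @enorm R d = fun x => (dotp x x `^ 2^-1)%R); last first.
  by apply/funext => x; rewrite powR12_sqrt.
apply: (@measurableT_comp _ _ _ _ _ _ (fun x : R => x `^ 2^-1)%R).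
  exact: measurable_powR.
apply: measurable_sum => i; apply: measurable_funM; exact: measurable_rV_coord.
Qed.

Lemma measurable_riesz_kernel beta : measurable_fun setT (riesz_kernel beta).
Proof.
have me : measurable_fun setT (fun x => (enorm x `^ beta)%R).
  exact: (measurableT_comp (measurable_powR beta) measurable_enorm).
rewrite (_ : riesz_kernel beta = fun x =>
  if (enorm x `^ beta == 0)%R then +oo else ((enorm x `^ beta) `^ (-1))%:E).
  apply: measurable_fun_ifT => //; first exact: measurable_fun_eqr.
  apply/measurable_EFinP.
  exact: (measurableT_comp (measurable_powR (-1)) me).
by apply/funext => x; rewrite riesz_kernelE.
Qed.

Lemma ler_coord_enorm x i : (`|x ord0 i| <= enorm x)%R.
Proof.
rewrite -sqrtr_sqr ler_wsqrtr// /dotp (bigD1 i)//= -expr2 lerDl.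
by apply: sumr_ge0 => j _; rewrite -expr2 sqr_ge0.
Qed.

(* {k > l} is a ball of radius l^(-1 / beta), which a cube contains. *)
Lemma weak_type_riesz_kernel beta : (0 < beta)%R ->
  weak_type L (2 ^+ d) (d%:R / beta) (riesz_kernel beta).
Proof.
(* The radius at which the kernel equals [l], that is [rho^beta = 1 / l]. The enclosing cube has
   volume [(2 rho)^d = 2^d l^(-d/beta)]. *)
move=> beta0 l l0; pose rho : R := (l `^ (- beta^-1))%R.
have rho0 : (0 < rho)%R by rewrite powR_gt0.
have rhobeta : (rho `^ beta = l^-1)%R.
  by rewrite -powRrM mulNr mulVf ?gt_eqF// powR_inv1// ltW.
pose I (i : 'I_d) : set (measurableTypeR R) := `](- rho)%R, rho[%classic.
pose B := [set x : 'rV[R]_d | forall i, I i (x ord0 i)].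
have mB : measurable B.
  rewrite (_ : B = \bigcap_(i in [set: 'I_d])
      ((fun x : 'rV[R]_d => x ord0 i : measurableTypeR R) @^-1` I i)).
    apply: fin_bigcap_measurable => // i _.
    rewrite -[X in measurable X]setTI.
    exact: (@measurable_rV_coord R d i measurableT _ (measurable_itv _)).
  by apply/seteqP; split => [x xI i _|x xI i]; [exact: xI|exact: (xI i)].
have mE : measurable [set x : 'rV[R]_d | l%:E < riesz_kernel beta x].
  rewrite -[X in measurable X]setTI; apply: emeasurable_fun_o_infty => //.
  exact: measurable_riesz_kernel.
apply: (@le_trans _ _ (L B)).
  apply: le_measure; rewrite ?inE//.
  - move=> x /= lx i; rewrite /I/= in_itv/= -ltr_norml.
    apply: (le_lt_trans (ler_coord_enorm x i)).
    rewrite ltNge; apply/negP => rhox; move: lx; rewrite riesz_kernelE.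
    have e0 : (0 < enorm x)%R by apply: lt_le_trans rhox.
    rewrite gt_eqF ?powR_gt0// lte_fin powR_inv1 ?powR_ge0//.
    apply/negP; rewrite -leNgt invf_ple ?posrE ?powR_gt0//.
    by rewrite -rhobeta ge0_ler_powR ?nnegrE ?(ltW beta0) ?(ltW rho0) ?(ltW e0).
rewrite lebesgue_rV_box; last by move=> i; exact: measurable_itv.
under eq_bigr do rewrite lebesgue_measure_itv/= lte_fin gtrN// -EFinD.
rewrite prodEFin prodr_const card_ord lee_fin.
rewrite opprK -mulr2n -(mulr_natl rho) exprMn.
rewrite le_eqVlt; apply/orP; left; apply/eqP; congr (_ * _)%R.
by rewrite -powR_mulrn ?powR_ge0// -powRrM; congr (_ `^ _)%R; ring.
Qed.

End riesz_kernel.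

(** * Densities in [L^r] *)

Section Lr_kernel.
Context (R : realType) (d : nat).
Local Open Scope ereal_scope.
Local Notation L := (@lebesgue_rV R d).

(** Chebyshev's inequality, from the pointwise bound of [l^r] times the indicator of [{h > l}] by
    [h^r]. *)
Lemma weak_type_Lr (r : R) (h : 'rV[R]_d -> R) : (0 < r)%R ->
  (forall x, 0 <= h x)%R -> h \in Lfun L r%:E ->
  weak_type L (fine ('N[L]_r%:E[EFin \o h]) `^ r) r (EFin \o h).
Proof.
move=> r0 h0 /(Lfun_powR_Lnorm r0)[mh Nh hE] l l0.
pose E := [set y : 'rV[R]_d | l%:E < (EFin \o h) y].
have mE : measurable E.
  rewrite -[X in measurable X]setTI; apply: emeasurable_fun_o_infty => //.
  exact/measurable_EFinP.
have mhr : measurable_fun setT (fun x => (`|h x| `^ r)%:E).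
  by apply: measurable_EFin_powR; exact: measurableT_comp.
have lr0 : (0 < l `^ r)%R by rewrite powR_gt0.
rewrite powRN EFinM lee_pdivlMr// muleC -[mkset _]/E.
rewrite -(setIT E) -integral_indic// -ge0_integralZl_EFin ?(ltW lr0)//; last first.
  exact/measurable_EFinP.
rewrite -hE; apply: ge0_le_integral => //.
- by move=> y _; rewrite mule_ge0// lee_fin ltW.
- by apply: measurable_funeM; exact/measurable_EFinP.
- move=> y _; rewrite indicE -EFinM lee_fin.
  have [|_] := boolP (_ \in _); last by rewrite mulr0 powR_ge0.
  rewrite inE /E/= lte_fin mulr1 => /ltW lh; rewrite ger0_norm//.
  by rewrite ge0_ler_powR// ?nnegrE ?(ltW r0) ?(ltW l0).
Qed.


End Lr_kernel.

(** * Convolution with a finite measure on [L^2] *)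

Section finite_measure_convolution.
Context (R : realType) (d : nat).
Local Open Scope ereal_scope.
Local Notation L := (@lebesgue_rV R d).

Lemma Lnorm2_le (h : 'rV[R]_d -> R) (a : R) :
  (forall x, 0 <= h x)%R -> (0 <= a)%R ->
  \int[L]_x (h x `^ 2)%:E <= (a `^ 2)%:E -> 'N[L]_2%:E[EFin \o h] <= a%:E.
Proof.
move=> h0 a0 ha; rewrite unlock.
rewrite (_ : \int[L]_x _ = \int[L]_x (h x `^ 2)%:E); last first.
  by apply: eq_integral => x _ /=; rewrite ger0_norm.
have -> : a%:E = (a `^ 2)%:E `^ 2^-1.
  by rewrite poweR_EFin -powRrM divff// powRr1.
apply: gt0_ler_poweR => //.
- by rewrite in_itv/= leey andbT integral_ge0// => x _; rewrite lee_fin powR_ge0.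
- by rewrite in_itv/= leey andbT lee_fin powR_ge0.
Qed.

Lemma ge0_integral_lebesgue_rV_subr (c : 'rV[R]_d) (f : 'rV[R]_d -> \bar R) :
  measurable_fun setT f -> (forall x, 0 <= f x) ->
  \int[L]_x f (x - c)%R = \int[L]_x f x.
Proof.
move=> mf f0.
have mf0 : measurable_fun setT (fun x : 'rV[R]_d => f (0 - x)%R).
  apply: measurableT_comp => //.
  exact: (measurable_rV_subl 0 (@measurable_id _ _ setT)).
rewrite -(ge0_integral_lebesgue_rV_subl 0 mf f0).
rewrite -(ge0_integral_lebesgue_rV_subl c mf0)//.
by apply: eq_integral => x _; rewrite sub0r opprB.
Qed.

(** After exchanging the integrals, Cauchy-Schwarz and translation invariance bound the integral in
    [y] by [a b] for every [x]; integrating in [x] gives the mass of [mu]. *)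
Lemma bounded_convolution_form_finite
    (nu : {measure set 'rV[R]_d -> \bar R})
    (mu : {finite_measure set 'rV[R]_d -> \bar R}) :
  (forall A, measurable A -> nu A = mu A) ->
  bounded_convolution_form nu 2 (fine (mu setT)).
Proof.
move=> numu f g a b mf mg f0 g0 a0 b0 fa gb.
have mfg : measurable_fun setT (fun z : 'rV[R]_d * 'rV[R]_d =>
    (f z.1 * g (z.1 - z.2))%:E).
  apply/measurable_EFinP; apply: measurable_funM; first exact: measurableT_comp.
  by apply: measurableT_comp => //; exact: measurable_fst_sub_snd.
have fg0 (z : 'rV[R]_d * 'rV[R]_d) : 0 <= (f z.1 * g (z.1 - z.2))%:E.
  by rewrite lee_fin mulr_ge0.
apply: (@le_trans _ _ (\int[L]_y \int[mu]_x (f y * g (y - x))%:E)).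
  rewrite le_eqVlt; apply/orP; left; apply/eqP; apply: eq_integral => y _.
  rewrite (eq_measure_integral mu); last by move=> A mA _; exact: numu.
  rewrite -ge0_integralZl_EFin//; first last.
  - exact: measurable_shift_subl.
  - by move=> x _; rewrite lee_fin.
rewrite (fubini_tonelli (m1 := L) (m2 := mu)
  (fun z : 'rV[R]_d * 'rV[R]_d => (f z.1 * g (z.1 - z.2))%:E))//.
apply: (@le_trans _ _ (\int[mu]_x (cst (a * b)%:E x))).
  apply: ge0_le_integral => //.
  - by move=> x _; apply: integral_ge0 => y _; exact: (fg0 (y, x)).
  - exact: (measurable_fun_fubini_tonelli_G _ mfg fg0).
  - move=> x _ /=.
    have mgx : measurable_fun setT (fun y : 'rV[R]_d => g (y - x)%R).
      exact: (measurableT_comp mg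
        (measurable_rV_sub (@measurable_id _ _ setT) (measurable_cst x))).
    have ga : \int[L]_y (g (y - x)%R `^ 2)%:E <= (b `^ 2)%:E.
      rewrite (ge0_integral_lebesgue_rV_subr x (f := fun y => (g y `^ 2)%:E))//.
        by apply/measurable_EFinP; exact: (measurableT_comp (measurable_powR _) mg).
      by move=> y; rewrite lee_fin powR_ge0.
    apply: (@le_trans _ _ ('N[L]_2%:E[EFin \o f] *
        'N[L]_2%:E[EFin \o (fun y : 'rV[R]_d => g (y - x)%R)])).
      apply: le_trans (hoelder L mf mgx _ _ _) => //; last first.
        by lra.
      rewrite Lnorm1 le_eqVlt; apply/orP; left; apply/eqP.
      by apply: eq_integral => y _; rewrite gee0_abs// lee_fin mulr_ge0.
    rewrite EFinM; apply: lee_pmul; rewrite ?Lnorm_ge0//.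
      exact: Lnorm2_le.
    exact: Lnorm2_le.
rewrite integral_cst// -[X in _ * X <= _](fineK (fin_num_measure mu _ measurableT)).
by rewrite -EFinM lee_fin le_eqVlt; apply/orP; left; apply/eqP; rewrite /=; ring.
Qed.

End finite_measure_convolution.

(** Clearing denominators, [2r/(2r-1) < 2d/(2d-alpha)] amounts to [d < alpha r], and
    [2r/(2r-1) < (d+alpha)/d] to [d + alpha < 2 alpha r], which follows from [d < alpha r] and
    [alpha <= alpha r]. *)
Lemma exponent_range (R : realType) (d : nat) (alpha r : R) :
  (1 <= d)%N -> 0 < alpha <= 2 -> 1 <= r -> d%:R < alpha * r ->
  1 < 2 * (r / (2 * r - 1)) /\
  ((2 * (r / (2 * r - 1)))%:E <
     Order.min ((2 * d%:R)%:E / (2 * d%:R - alpha)%:E)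
               ((d%:R + alpha) / d%:R)%:E)%E.
Proof.
rewrite -(ler_nat R) => d1 /andP[a0 a2] r1 dr.
have r0 : 0 < 2 * r - 1 by lra.
have ar : alpha <= alpha * r by rewrite ler_peMr// ltW.
have d0 : 0 < d%:R :> R by lra.
split; first by rewrite mulrA ltr_pdivlMr//; lra.
rewrite lt_min; apply/andP; split; last first.
  rewrite lte_fin mulrA ltr_pdivrMr// mulrAC ltr_pdivlMr//.
  rewrite -subr_gt0 (_ : _ - _ = 2 * (alpha * r) - d%:R - alpha); last by ring.
  lra.
(* If [2d = alpha] the quotient is [+oo]; otherwise [2d - alpha] is positive, since
   [alpha <= 2 <= 2d]. *)
rewrite inver; case: ifPn => [_|da].
  by rewrite gt0_muley ?ltry// lte_fin mulr_gt0.
have {}da : 0 < 2 * d%:R - alpha by rewrite lt_neqAle eq_sym da/=; lra.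
rewrite -EFinM lte_fin mulrA ltr_pdivrMr// mulrAC ltr_pdivlMr//.
rewrite -subr_gt0 (_ : _ - _ = 2 * (alpha * r - d%:R)); last by ring.
by rewrite mulr_gt0// subr_gt0.
Qed.

(* In \bar R, x / 0 = +oo for x > 0, so that 2d / (2d - alpha) is +oo when
   2d - alpha = 0.  The first two clauses of the conclusion say that the
   integrals in the inequality are well defined. *)
Theorem proposition3p2 (R : realType) (d : nat) (alpha beta : R)
    (mu : {finite_measure set 'rV[R]_d -> \bar R})
    (gamma : {measure set 'rV[R]_d -> \bar R})
    (d_ge1 : (1 <= d)%N)
    (alpha_range : 0 < alpha <= 2)
    (gamma_sym : symmetric_measure gamma)
    (gamma_nnd : nonneg_definite gamma)
    (hA : assumption_A alpha beta mu gamma) :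
  exists q C : R,
    [/\ 1 < 2 * q,
        ((2 * q)%:E < Order.min ((2 * d%:R)%:E / (2 * d%:R - alpha)%:E)
                                ((d%:R + alpha) / d%:R)%:E)%E
      & forall f g : 'rV[R]_d -> R,
          f \in Lfun (lebesgue_rV d) (2 * q)%:E ->
          g \in Lfun (lebesgue_rV d) (2 * q)%:E ->
          [/\ {ae lebesgue_rV d, forall y,
                 gamma.-integrable setT (fun x => (g (y - x))%:E)},
              (lebesgue_rV d).-integrable setT
                (fun y => ((f y)%:E * conv_measure g gamma y)%E)
            & (\int[lebesgue_rV d]_y ((f y)%:E * conv_measure g gamma y)
               <= C%:E * 'N[lebesgue_rV d]_((2 * q)%:E)[EFin \o f]
                       * 'N[lebesgue_rV d]_((2 * q)%:E)[EFin \o g])%E]].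
Proof.
(* Each case has only to supply [r] and a bounded form at the exponent [2r/(2r-1)]; then
   [q = r/(2r-1)]. *)
suff [r [C [r1 dr mconv bconv]]] : exists r C : R,
    [/\ 1 <= r, d%:R < alpha * r, measurable_convolution gamma
      & bounded_convolution_form gamma (2 * (r / (2 * r - 1))) C].
  have [q1 qmin] := exponent_range d_ge1 alpha_range r1 dr.
  exists (r / (2 * r - 1)), C; split => // f g fq gq.
  by apply: bounded_convolution_formP => //; exact: lt_trans q1.
have /andP[alpha0 _] := alpha_range.
have d0 : 0 < d%:R :> R by rewrite ltr0n.
have [/andP[beta0 _] _ riesz
  [ba|[bd d1 alpha1]|[bd ad [h [h0 gammah [r [dr hr _]]]]]]] := hA.
(* Case (i), with [r = d / beta]: [beta < d] gives [r > 1], and [beta < alpha] gives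
   [d < alpha r]. *)
- move: ba; rewrite lt_min => /andP[ba bd].
  have gammak : has_density gamma
      (fun x => \int[mu]_z riesz_kernel beta (x - z))%E.
    by case: riesz => [[]//|[bE _]]; rewrite bE ltxx in bd.
  have r1 : 1 < d%:R / beta by rewrite ltr_pdivlMr// mul1r.
  exists (d%:R / beta),
    (2 * weak_young_cst (2 ^+ d) (d%:R / beta) * fine (mu setT)).
  split.
  + exact: ltW.
  + by rewrite mulrA ltr_pdivlMr// mulrC ltr_pM2r.
  + apply: measurable_convolution_density gammak.
      apply: measurable_convolution_sigma_finite; last exact: riesz_kernel_ge0.
      exact: measurable_riesz_kernel.
    by move=> x; apply: integral_ge0 => z _; exact: riesz_kernel_ge0.
  + rewrite mulrA.
    apply: bounded_convolution_form_integral_weak_type gammak => //.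
    * exact: measurable_riesz_kernel.
    * exact: riesz_kernel_ge0.
    * exact: weak_type_riesz_kernel.
(* Case (ii), with [r = 1], so that [2q = 2]; since [d = 1], the condition [d < alpha r] is
   [1 < alpha]. *)
- have gammamu : forall A : set 'rV[R]_d, measurable A -> gamma A = mu A.
    by case: riesz => [[/andP[_]]|[]//]; rewrite bd ltxx.
  exists 1, (fine (mu setT)); split => //.
  + by rewrite d1 mulr1.
  + move=> u mfu u0.
    have := measurable_convolution_sigma_finite mu mfu u0.
    congr (measurable_fun _ _); apply/funext => y.
    by apply/esym/eq_measure_integral => A mA _; exact: gammamu.
  + rewrite (_ : 2 * (1 / (2 * 1 - 1)) = 2).
      exact: bounded_convolution_form_finite.
    by field.
(* Case (iii), with the integrability exponent of the density as [r]: [alpha <= d] and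
   [d / alpha < r] give [r > 1]. *)
- have r1 : 1 < r.
    by apply: le_lt_trans dr; rewrite ler_pdivlMr// mul1r.
  have r0 : 0 < r by rewrite (lt_trans _ r1).
  have [mh _ _] := Lfun_powR_Lnorm r0 hr.
  have mEh : measurable_fun setT (EFin \o h) by exact/measurable_EFinP.
  exists r; eexists; split.
  + exact: ltW.
  + by rewrite mulrC -ltr_pdivrMr.
  + exact: measurable_convolution_density gammah.
  + have hEge0 x : (0 <= (EFin \o h) x)%E by rewrite lee_fin.
    rewrite mulrA; exact: (bounded_convolution_form_weak_type r1 (powR_ge0 _ _)
      mEh hEge0 (weak_type_Lr r0 h0 hr) gammah).
Qed.
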